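(* Let $\mathbb{K}$ be a commutative field, $n$ a positive integer, and $V$ a linear subspace of $\operatorname{M}_n(\mathbb{K})$ with $\operatorname{codim} V<n-1$. Let $f : V \to V$ be a linear bijection such that $f\bigl(V \cap \operatorname{GL}_n(\mathbb{K})\bigr) \subset \operatorname{GL}_n(\mathbb{K})$. Then $f$ extends to a Frobenius automorphism of $\operatorname{M}_n(\mathbb{K})$, unless $n=3$, $\operatorname{codim} V=1$ and $\mathbb{K} \simeq \mathbb{F}_2$ (i.e. the conclusion is asserted whenever these three conditions do not all hold).
   Context: $\operatorname{M}_n(\mathbb{K})$ is the space of $n\times n$ matrices over $\mathbb{K}$, $\operatorname{GL}_n(\mathbb{K})$ its set of invertible elements, and $\operatorname{codim} V$ denotes the codimension of $V$ in $\operatorname{M}_n(\mathbb{K})$. A Frobenius automorphism of $\operatorname{M}_n(\mathbb{K})$ is a map of the form $M\mapsto PMQ$ or of the form $M \mapsto PM^TQ$ for some $P,Q\in\operatorname{GL}_n(\mathbb{K})$. *)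

(* Defs.v *)
From HB Require Import structures.
From mathcomp Require Import all_boot all_order all_algebra.

Set Implicit Arguments.
Unset Strict Implicit.
Unset Printing Implicit Defensive.

Import GRing.Theory.
Local Open Scope ring_scope.

(* The subtraction is truncated, but never truncates since (V <= fullv)%VS. *)
Definition codimv (K : fieldType) (vT : vectType K) (V : {vspace vT}) : nat :=
  (\dim {:vT} - \dim V)%N.

Definition Frobenius_automorphism (K : fieldType) (n : nat)
    (u : 'M[K]_n -> 'M[K]_n) : Prop :=
  exists P Q : 'M[K]_n, [/\ P \in unitmx, Q \in unitmx &
    (forall M, u M = P *m M *m Q) \/ (forall M, u M = P *m M^T *m Q)].

Definition field_isomorphic (K L : fieldType) : Prop :=
  exists phi : {rmorphism K -> L}, bijective phi.

(* Main.v *)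
Require Import Defs.
From HB Require Import structures.
From Stdlib Require Import Classical.
From mathcomp Require Import all_boot all_order all_algebra perm.
From mathcomp Require Import zify.

Set Implicit Arguments.
Unset Strict Implicit.
Unset Printing Implicit Defensive.
Import GRing.Theory.
Local Open Scope ring_scope.

(** Let c be the codimension of V and f the given bijection, so that c + 2 <= n.
    The proof studies how f acts on the spaces of those M in V with M x = 0, for
    x a nonzero vector: they consist of singular matrices, and their codimension
    in the space of all matrices is at most n + c, hence at most 2n - 2.

    A compression space is the set of the M with U M X^T = 0, that is, of the
    matrices that map the span of the rows of X (seen as columns) into the kernel
    of U; it consists of singular matrices as soon as rank U + rank X > n. The
    main tool is the theorem of Atkinson and Lloyd, over an arbitrary field: a
    linear space of singular n x n matrices with codimension at most 2n - 2 lies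
    in a compression space with rank U + rank X = n + 1, except possibly for n = 3
    over the field with two elements ([atkinson_lloyd]). It is deduced from
    Dieudonné's theorem, by which an affine space of singular matrices has
    codimension at least n ([dieudonne]), and from the description of the case of
    equality ([dieudonne_eq]). Both rest on one remark: if M and M + e^T w are
    singular, then so is the matrix of size n - 1 obtained from M by taking the
    quotient by e and the restriction to the kernel of w ([cross_nonunit]). If some
    e occurs in no rank one matrix e^T w of the space, then its matrices are
    determined by their reductions modulo e, and the dependence is linear and
    range-compatible; such dependences come from a row operation
    ([range_compatible]), hence the space has a common left kernel
    ([singular_missing_col]). The opposite case, in which each e and each w occurs
    in a rank one matrix, is an induction on n ([singular_rank1_compressible]).

    Next, f also maps singular matrices to singular matrices
    ([preserves_singular]). This is Dixon's argument: in the n-th tensor power, f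
    and its inverse induce linear maps that stabilise the finite dimensional span
    of the images of the singular matrices of V, on which the determinant is a
    linear form that vanishes.

    Consequently f maps the space { M in V | M x = 0 }, which is a maximal singular
    subspace of V ([killed_maximal]), onto the intersection of V with a
    compression space (U, X) ([image_killed]). For x = z, z', z + z' with (z, z')
    in general position, the three images meet pairwise in one and the same
    subspace; a comparison of the rank one matrices which they contain, together
    with a count of dimensions, leaves only the extreme cases rank X = 1 for the
    three points, or rank U = 1 for the three points ([line_point_type],
    [line_no_mixed]). In the first case M x = 0 implies f(M) y = 0 for some y
    attached to x, so f(M) y = u (M x); general position forces u to be
    independent of x up to a scalar and y to depend linearly on x, hence
    f(M) = P M Q ([kernel_preserver]). In the second case the same argument
    applies to M |-> f(M)^T.

    Vectors are row vectors throughout: M x is written M *m x^T, and the rank one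
    matrices are the e^T *m w. *)

(** * Sandwich maps and compression spaces *)

Section Sandwich.
Variable K : fieldType.

(** The linear map M |-> U M X^T. *)
Definition sandwich m n p q (U : 'M[K]_(p, m)) (X : 'M[K]_(q, n)) :
    'Hom('M[K]_(m, n), 'M[K]_(p, q)) :=
  linfun (mulmxr X^T \o mulmx U).

Lemma sandwichE m n p q (U : 'M[K]_(p, m)) (X : 'M[K]_(q, n)) M :
  sandwich U X M = U *m M *m X^T.
Proof. by rewrite lfunE. Qed.

(** The space of the M with U M X^T = 0. Only the row spaces of U and X matter;
    transposition exchanges the two. *)
Definition compspace m n p q (U : 'M[K]_(p, m)) (X : 'M[K]_(q, n)) :
  {vspace 'M[K]_(m, n)} := lker (sandwich U X).

Lemma compspaceP m n p q (U : 'M[K]_(p, m)) (X : 'M[K]_(q, n)) M :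
  reflect (U *m M *m X^T = 0) (M \in compspace U X).
Proof. by rewrite memv_ker sandwichE; apply: eqP. Qed.

Lemma dimvM m n : \dim {: 'M[K]_(m, n)} = (m * n)%N.
Proof. by rewrite dimvf dim_matrix. Qed.

Lemma leq_dimM m n (A : {vspace 'M[K]_(m, n)}) : (\dim A <= m * n)%N.
Proof. by rewrite -dimvM dimvS ?subvf. Qed.

Lemma rank_factorization m n (U : 'M[K]_(m, n)) :
  exists r (C : 'M_(m, r)) (R : 'M_(r, n)) C' R',
  [/\ \rank U = r, U = C *m R, C' *m C = 1%:M & R *m R' = 1%:M].
Proof.
have /row_freeP[R' RR'] := row_base_free U.
have /row_fullP[C' C'C] := col_base_full U.
by exists (\rank U), (col_base U), (row_base U), C', R'; rewrite mulmx_base.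
Qed.

Lemma dim_limg_sandwich m n p q (U : 'M[K]_(p, m)) (X : 'M[K]_(q, n)) :
  \dim (limg (sandwich U X)) = (\rank U * \rank X)%N.
Proof.
have [r [C [R [C' [R' [-> -> C'C RR']]]]]] := rank_factorization U.
have [s [D [S [D' [S' [-> -> D'D SS']]]]]] := rank_factorization X.
move/(congr1 trmx): D'D; rewrite trmx_mul trmx1 => D'D.
move/(congr1 trmx): SS'; rewrite trmx_mul trmx1 => SS'.
have -> : limg (sandwich (C *m R) (D *m S)) = limg (sandwich C D).
  apply: subv_anti; apply/andP; split; apply/subvP=> N /memv_imgP[M _ ->];
    rewrite sandwichE; apply/memv_imgP.
    exists (R *m M *m S^T); first exact: memvf.
    by rewrite sandwichE trmx_mul !mulmxA.
  exists (R' *m M *m S'^T); first exact: memvf.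
  rewrite sandwichE trmx_mul !mulmxA -[C *m R *m _]mulmxA RR'.
  by rewrite mulmx1 -[_ *m S'^T *m _]mulmxA SS' mulmx1.
rewrite limg_dim_eq ?dimvM //; apply/eqP; rewrite -subv0; apply/subvP=> M.
rewrite memv_cap memvf memv_ker sandwichE memv0 /= => /eqP h.
apply/eqP; have := congr1 (fun N => C' *m N *m D'^T) h.
by rewrite /= !mulmxA C'C mul1mx -mulmxA D'D mulmx1 mulmx0 mul0mx.
Qed.

Lemma dim_compspace m n p q (U : 'M[K]_(p, m)) (X : 'M[K]_(q, n)) :
  (\dim (compspace U X) + \rank U * \rank X = m * n)%N.
Proof.
by rewrite -dim_limg_sandwich -dimvM -(limg_ker_dim (sandwich U X) fullv) capfv.
Qed.

(** The equation U M X^T = 0 cuts the dimension of a subspace by at most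
    rank U * rank X. *)
Lemma dim_cap_compspace m n p q (U : 'M[K]_(p, m)) (X : 'M[K]_(q, n)) A :
  (\dim A <= \dim (A :&: compspace U X) + \rank U * \rank X)%N.
Proof.
rewrite -[leqLHS](limg_ker_dim (sandwich U X) A) leq_add2l -dim_limg_sandwich.
by rewrite dimvS ?limgS ?subvf.
Qed.

End Sandwich.

(** [reverse_coercion] occurs around some of the matrix types and makes equal
    dimensions syntactically different. *)
Ltac dlia := unfold reverse_coercion in *; lia.

(** * Frames and Dieudonné's theorem on affine spaces of singular matrices *)

Section Frames.
Variable K : fieldType.

Lemma unitmx_of_ker n (M : 'M[K]_n) :
  (forall v : 'rV_n, M *m v^T = 0 -> v = 0) -> M \in unitmx.
Proof.
move=> inj; rewrite -unitmx_tr -row_free_unit -kermx_eq0 -submx0.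
apply/rV_subP=> v /sub_kermxP vM; rewrite (inj v) ?sub0mx //.
by apply: trmx_inj; rewrite trmx_mul trmxK vM trmx0.
Qed.

Lemma unitmx_ker n (M : 'M[K]_n) (v : 'rV_n) :
  M \in unitmx -> M *m v^T = 0 -> v = 0.
Proof.
move=> Mu Mv; apply: trmx_inj.
by rewrite -[v^T]mul1mx -(mulVmx Mu) -mulmxA Mv mulmx0 trmx0.
Qed.

Lemma ker_of_nonunitmx n (M : 'M[K]_n) :
  M \notin unitmx -> exists2 v : 'rV_n, v != 0 & M *m v^T = 0.
Proof.
rewrite -unitmx_tr -row_free_unit -kermx_eq0 => /rowV0Pn[v /sub_kermxP vM v0].
by exists v => //; apply: trmx_inj; rewrite trmx_mul trmxK vM trmx0.
Qed.

(** A basis (e, Y) of the space of rows, with its dual basis (a, B): the rows of B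
    are a basis of the linear forms that vanish at e. As B e^T = 0, the product
    B *m M is the reduction of M modulo e, and M *m B^T is the restriction of M to
    the kernel of the linear form e. *)
Definition frame m (e a : 'rV[K]_m.+1) (Y B : 'M[K]_(m, m.+1)) : Prop :=
  [/\ e *m a^T = 1%:M, B *m e^T = 0, a *m Y^T = 0, B *m Y^T = 1%:M
    & e^T *m a + Y^T *m B = 1%:M].

Lemma exists_frame m (e : 'rV[K]_m.+1) :
  e != 0 -> exists a Y B, frame e a Y B.
Proof.
move=> e0; have re : \rank e = 1%N by rewrite rank_rV e0.
pose P : 'M_(1 + m, 1 + m) := row_ebase e; pose Q := invmx P.
pose u := usubmx P; pose Y := dsubmx P; pose b := lsubmx Q; pose C := rsubmx Q.
have Pu : P \in unitmx := row_ebase_unit e.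
have := mulmxV Pu; rewrite -/Q -[P]vsubmxK -[Q]hsubmxK -/u -/Y -/b -/C.
rewrite mul_col_row scalar_mx_block => /eq_block_mx[ub uC Yb YC].
have := mulVmx Pu; rewrite -/Q -[P]vsubmxK -[Q]hsubmxK -/u -/Y -/b -/C.
rewrite mul_row_col => bu.
have [k k0 eE] : exists2 k, k != 0 & e = k *: u.
  have eu : e = col_ebase e *m u.
    have pidP : (pid_mx 1 : 'M_(1, 1 + m)) *m P = u.
      by rewrite pid_mx_row -[P]vsubmxK mul_row_col mul1mx mul0mx addr0.
    by rewrite -{1}(mulmx_ebase e) re -pidP mulmxA.
  exists (col_ebase e 0 0); last by rewrite {1}eu {1}[col_ebase e]mx11_scalar mul_scalar_mx.
  apply: contraNneq e0 => c0.
  by rewrite eu [col_ebase e]mx11_scalar c0 mul_scalar_mx scale0r.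
have trZ p q (c : K) (M : 'M_(p, q)) : (c *: M)^T = c *: M^T.
  by rewrite linearZ.
exists (k^-1 *: b^T), Y, C^T; rewrite /frame eE !trZ !trmxK; split.
- by rewrite -scalemxAl -scalemxAr ub scalerA divff // scale1r.
- by rewrite -scalemxAr -trmx_mul uC trmx0 scaler0.
- by rewrite -scalemxAl -trmx_mul Yb trmx0 scaler0.
- by rewrite -trmx_mul YC trmx1.
rewrite -scalemxAl -scalemxAr scalerA divff // scale1r.
by rewrite -!trmx_mul -linearD /= bu trmx1.
Qed.

Lemma frame_neq0 m (e a : 'rV[K]_m.+1) Y B : frame e a Y B -> e != 0.
Proof.
case=> ea _ _ _ _; apply: contraTneq (oner_neq0 K) => e0.
by have := congr1 (fun M : 'M_1 => M 0 0) ea; rewrite e0 mul0mx !mxE negbK eq_sym => ->.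
Qed.

Lemma frame_mulT m (e a : 'rV[K]_m.+1) Y B : frame e a Y B -> e *m B^T = 0.
Proof. by case=> _ Be _ _ _; rewrite -[e]trmxK -trmx_mul Be trmx0. Qed.

Lemma frame_free m (e a : 'rV[K]_m.+1) Y B : frame e a Y B -> \rank B = m.
Proof. by case=> _ _ _ BY _; apply/eqP/row_freeP; exists Y^T. Qed.

Lemma frame_dec m (e a : 'rV[K]_m.+1) Y B (v : 'rV_m.+1) : frame e a Y B ->
  v^T = e^T *m (a *m v^T) + Y^T *m (B *m v^T).
Proof. by case=> _ _ _ _ E; rewrite !mulmxA -mulmxDl E mul1mx. Qed.

Lemma frame_decM m p (e a : 'rV[K]_m.+1) Y B (M : 'M_(m.+1, p)) :
  frame e a Y B -> M = e^T *m (a *m M) + Y^T *m (B *m M).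
Proof. by case=> _ _ _ _ E; rewrite !mulmxA -mulmxDl E mul1mx. Qed.

Lemma frame_decT m p (e a : 'rV[K]_m.+1) Y B (M : 'M_(m.+1, p)) :
  frame e a Y B -> M = a^T *m (e *m M) + B^T *m (Y *m M).
Proof.
case=> _ _ _ _ /(congr1 trmx); rewrite linearD /= !trmx_mul !trmxK trmx1 => E.
by rewrite !mulmxA -mulmxDl E mul1mx.
Qed.

(** The remark on which all the inductions on the size rest. In a basis where
    e^T w is the matrix unit E_11, it says that M and M + E_11 cannot both be
    singular if the complementary minor of the first entry is nonzero. The proof
    compares kernel vectors of M and M + e^T w and is independent of the field. *)
Lemma cross_nonunit m (e a w a' : 'rV[K]_m.+1) Y B Y' B' M :
  frame e a Y B -> frame w a' Y' B' ->
  M \notin unitmx -> M + e^T *m w \notin unitmx -> B *m M *m B'^T \notin unitmx.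
Proof.
move=> Fe Fw /ker_of_nonunitmx[x x0 Mx] /ker_of_nonunitmx[x' x0' Mx'].
have [_ Be _ _ _] := Fe; apply/negP => Nu.
have ker0 (y : 'rV_m.+1) : w *m y^T = 0 -> B *m M *m y^T = 0 -> y = 0.
  move=> wy; rewrite (frame_decT y^T Fw) wy mulmx0 add0r mulmxA => h.
  apply: trmx_inj; rewrite (frame_decT y^T Fw) wy mulmx0 add0r trmx0.
  have /(unitmx_ker Nu) : B *m M *m B'^T *m ((Y' *m y^T)^T)^T = 0 by rewrite trmxK.
  by move/(congr1 trmx); rewrite trmxK trmx0 => ->; rewrite mulmx0.
pose s := (w *m x^T) 0 0; pose s' := (w *m x'^T) 0 0.
have wx : w *m x^T = s%:M by rewrite {1}[_ *m _]mx11_scalar.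
have wx' : w *m x'^T = s'%:M by rewrite {1}[_ *m _]mx11_scalar.
have BM' : B *m M *m x'^T = 0.
  move: (congr1 (mulmx B) Mx').
  by rewrite mulmxDl mulmxDr !mulmxA Be !mul0mx addr0 mulmx0.
have BM : B *m M *m x^T = 0 by rewrite -mulmxA Mx mulmx0.
have s0 : s != 0.
  apply: contraNneq x0 => s0; apply/eqP/ker0 => //.
  by rewrite wx s0 raddf0.
have s0' : s' != 0.
  apply: contraNneq x0' => s0'; apply/eqP/ker0 => //.
  by rewrite wx' s0' raddf0.
have mulZ p (N : 'M_(p, m.+1)) :
    N *m (s' *: x - s *: x')^T = s' *: (N *m x^T) - s *: (N *m x'^T).
  by rewrite !raddfB /= !linearZ.
have E : s' *: x - s *: x' = 0.
  apply: ker0; rewrite mulZ ?wx ?wx' ?BM ?BM' ?scaler0 ?subrr //.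
  by rewrite !scale_scalar_mx mulrC subrr.
have Mx0' : M *m x'^T = 0.
  move: (mulZ _ M) => /eqP; rewrite E trmx0 mulmx0 Mx scaler0 sub0r eq_sym.
  by rewrite oppr_eq0 scaler_eq0 (negPf s0) => /eqP.
move: Mx'; rewrite mulmxDl Mx0' add0r -mulmxA wx' mul_mx_scalar => /eqP.
rewrite scaler_eq0 (negPf s0') => /eqP e0.
by have := frame_neq0 Fe; rewrite -[e]trmxK e0 trmx0 eqxx.
Qed.

Lemma frame_rank1 m p (e a : 'rV[K]_m.+1) Y B (M : 'M_(m.+1, p)) :
  frame e a Y B -> B *m M = 0 -> M = e^T *m (a *m M).
Proof. by move=> F BM; rewrite {1}(frame_decM M F) BM mulmx0 addr0. Qed.

Lemma rank1_span m n (A : {vspace 'M[K]_(m, n)}) :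
  (forall (e : 'rV_m) (w : 'rV_n), e^T *m w \in A) -> A = fullv.
Proof.
move=> h; apply: subv_anti; rewrite subvf; apply/subvP => M _.
rewrite [M]matrix_sum_delta memv_suml // => i _; rewrite memv_suml // => j _.
apply: memvZ; have := h (delta_mx 0 i) (delta_mx 0 j).
by rewrite trmx_delta mul_delta_mx.
Qed.

(** Dieudonné: an affine space of singular matrices has codimension at least n. *)
Theorem dieudonne n (p : 'M[K]_n) (A : {vspace 'M[K]_n}) :
  (forall M, M \in A -> p + M \notin unitmx) -> (\dim A + n <= n * n)%N.
Proof.
elim: n p A => [|m IH] p A sing.
  have := sing 0 (mem0v A); rewrite addr0.
  by rewrite unitmxE det_mx00 unitr1.
rewrite leqNgt; apply/negP => big.
have cross (e w : 'rV_m.+1) : e != 0 -> w != 0 -> e^T *m w \in A ->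
    (forall e' : 'rV_m.+1, e'^T *m w \in A) /\
    (forall w' : 'rV_m.+1, e^T *m w' \in A).
  move=> /exists_frame[a [Y [B Fe]]] /exists_frame[a' [Y' [B' Fw]]] ewA.
  pose f := sandwich B B'.
  have := IH (f p) (f @: A)%VS.
  (* The cross of e^T w is the kernel of f; as the image of f has codimension at
     least m in the matrices of size m, the cross must lie in A. *)
  have -> : (forall N, N \in (f @: A)%VS -> f p + N \notin unitmx) <-> True.
    split=> // _ _ /memv_imgP[M MA ->]; rewrite -linearD /= sandwichE.
    apply: (cross_nonunit Fe Fw (sing _ MA)); rewrite -addrA sing //.
    by rewrite memvD.
  move=> /(_ I) dimf.
  have dimk : (\dim (A :&: compspace B B') + \dim (f @: A) = \dim A)%N.
    exact: limg_ker_dim.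
  have dimc := dim_compspace B B'.
  rewrite (frame_free Fe) (frame_free Fw) in dimc.
  have sub : (compspace B B' <= A)%VS.
    apply/capv_idPr/eqP; rewrite eqEdim capvSr /=.
    dlia.
  have [_ Be _ _ _] := Fe.
  split=> [e'|w']; apply: (subvP sub); apply/compspaceP.
    by rewrite -!mulmxA (frame_mulT Fw) !mulmx0.
  by rewrite !mulmxA Be !mul0mx.
have e0 : (delta_mx 0 0 : 'rV[K]_m.+1) != 0.
  by apply/eqP=> /matrixP/(_ 0 0)/eqP; rewrite !mxE !eqxx oner_eq0.
case: (exists_frame e0) => a [Y [B Fe]].
have := dim_cap_compspace B (1%:M : 'M_m.+1) A.
rewrite (frame_free Fe) mxrank1 => dimA.
have : (A :&: compspace B (1%:M : 'M_m.+1) != 0)%VS.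
  by rewrite -dimv_eq0; dlia.
rewrite -vpick0; set M := vpick _ => M0.
have := memv_pick (A :&: compspace B (1%:M : 'M_m.+1))%VS; rewrite -/M.
rewrite memv_cap => /andP[MA /compspaceP]; rewrite trmx1 mulmx1 => BM.
have ME := frame_rank1 Fe BM; have w0 : a *m M != 0.
  by apply: contraNneq M0 => h; rewrite ME h mulmx0.
rewrite ME in MA; have [h _] := cross _ _ e0 w0 MA.
(* Crosses propagate from one rank one matrix to all of them. *)
have Afull : A = fullv.
  apply: rank1_span => e w; have [->|en0] := eqVneq e 0.
    by rewrite trmx0 mul0mx mem0v.
  by have [_ ->] := cross _ _ en0 w0 (h e).
have := sing (1%:M - p); rewrite Afull memvf addrC subrK unitmx1.
by move/(_ isT).
Qed.

End Frames.

(** * Vectors in general position with respect to a space of matrices *)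

Section Regular.
Variable K : fieldType.

(** A proper subspace of a space of columns is killed by a nonzero row. *)
Lemma annihilator m (A : {vspace 'cV[K]_m}) :
  (\dim A < m)%N ->
  exists2 l : 'rV_m, l != 0 & forall v, v \in A -> l *m v = 0.
Proof.
move=> dimA; pose B := \matrix_(i < \dim A) ((vbasis A)`_i)^T.
have : kermx B^T != 0.
  rewrite -mxrank_eq0 mxrank_ker mxrank_tr.
  by rewrite subn_eq0 -ltnNge (leq_ltn_trans (rank_leq_row B)).
move=> /rowV0Pn[l /sub_kermxP lB l0]; exists l => // v vA.
rewrite (coord_vbasis vA) mulmx_sumr big1 // => i _.
rewrite -scalemxAr (_ : l *m _ = 0) ?scaler0 //.
have := congr1 (col i) lB; rewrite colE -mulmxA -colE col0 => <-; congr (_ *m _).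
by rewrite -tr_row rowK trmxK.
Qed.

Lemma factor_through (vT : vectType K) m p (A : {vspace vT})
    (f : 'Hom(vT, 'cV[K]_m)) (g : 'Hom(vT, 'cV[K]_p)) :
  (forall v, exists2 M, M \in A & f M = v) ->
  (forall M, M \in A -> f M = 0 -> g M = 0) ->
  exists u : 'M_(p, m), forall M, M \in A -> g M = u *m f M.
Proof.
move=> onto fg.
have /fin_all_exists2[F FA fF] : forall i : 'I_m,
    exists2 M, M \in A & f M = delta_mx i 0 by move=> i; apply: onto.
exists (\matrix_(i, j) g (F j) i 0) => M MA.
pose N := \sum_i f M i 0 *: F i.
have NA : N \in A by rewrite memv_suml // => i _; rewrite memvZ.
have fN : f N = f M.
  rewrite linear_sum [RHS]matrix_sum_delta; apply: eq_bigr => i _.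
  by rewrite linearZ /= fF big_ord1.
have gN : g M = g N.
  apply/eqP; rewrite -subr_eq0 -linearB; apply/eqP/fg; first exact: memvB.
  by rewrite linearB /= fN subrr.
rewrite gN linear_sum; apply/colP => i; rewrite summxE !mxE.
by apply: eq_bigr => j _; rewrite linearZ !mxE mulrC.
Qed.

(** The values M z'^T, for M in V with M z^T = 0, are not contained in any proper
    subspace. *)
Definition transverse m n (V : {vspace 'M[K]_(m, n)}) (z z' : 'rV[K]_n) :=
  forall l : 'rV_m,
    (forall M, M \in V -> M *m z^T = 0 -> l *m (M *m z'^T) = 0) -> l = 0.

Lemma transverse_onto m n (V : {vspace 'M[K]_(m, n)}) z z' :
  transverse V z z' ->
  forall q : 'cV_m, exists M, [/\ M \in V, M *m z^T = 0 & M *m z'^T = q].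
Proof.
move=> tr q; pose B := (V :&: compspace (1%:M : 'M_m) z)%VS.
pose f := sandwich (1%:M : 'M[K]_m) z'.
have fE M : f M = M *m z'^T by rewrite sandwichE mul1mx.
have BP M : M \in B -> M \in V /\ M *m z^T = 0.
  by rewrite memv_cap => /andP[-> /compspaceP]; rewrite mul1mx.
have : (f @: B)%VS = fullv.
  apply/eqP; rewrite eqEdim subvf /= dimvM muln1 leqNgt; apply/negP.
  case/annihilator => l l0 lf; case/eqP: l0; apply: tr => M MV Mz.
  rewrite -fE lf // memv_img // memv_cap MV; apply/compspaceP.
  by rewrite mul1mx.
move=> ff; have : q \in (f @: B)%VS by rewrite ff memvf.
by case/memv_imgP => M /BP[MV Mz] ->; exists M; split; rewrite -?fE.
Qed.

(** The vectors that are not transverse to z lie in a subspace of dimension at most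
    rank z + codim V. Indeed k of them, linearly independent modulo z, provide k
    linearly independent linear forms that vanish on the space of those M in V with
    M z^T = 0. The matrix W below is dual to the family Z of these vectors, and the
    row i of L is the linear form attached to the row i of Z. *)
Lemma transverse_exists m n (V : {vspace 'M[K]_(m, n)}) (z : 'rV[K]_n) c :
  (m * n <= \dim V + c)%N ->
  exists S : 'M_n, [/\ (z <= S)%MS, (\rank S <= \rank z + c)%N &
    forall z' : 'rV_n, ~~ (z' <= S)%MS -> transverse V z z'].
Proof.
move=> dimV.
pose Q k := exists (Z : 'M[K]_(k, n)) (W : 'M_(n, k)) (L : 'M_(k, m)),
  [/\ Z *m W = 1%:M, z *m W = 0, forall i, row i L != 0 &
    forall i M, M \in V -> M *m z^T = 0 -> row i L *m (M *m (row i Z)^T) = 0].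
have Qbound k : Q k -> (k <= c)%N.
  case=> Z [W [L [ZW zW L0 LV]]].
  have /fin_all_exists[q qE] : forall i, exists q : 'cV[K]_m, row i L *m q = 1%:M.
    move=> i; have /existsP[j Lj] : [exists j, row i L 0 j != 0].
      apply: contraNT (L0 i); rewrite negb_exists => /forallP h.
      by apply/eqP/rowP => j; rewrite [RHS]mxE; apply/eqP; move: (h j); rewrite negbK.
    exists ((row i L 0 j)^-1 *: delta_mx j 0).
    rewrite -scalemxAr -colE; apply/matrixP => x y; rewrite !ord1.
    by rewrite !mxE mulVf //; move: Lj; rewrite mxE.
  pose Qm := \matrix_(i, j) q j i 0.
  (* The image of tau has dimension k, is contained in the M with M z^T = 0, and
     meets V trivially. *)
  pose tau := linfun (mulmxr W^T \o (mulmx Qm \o (@diag_mx K k))).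
  have tauE t : tau t = Qm *m diag_mx t *m W^T by rewrite lfunE.
  have tz t : tau t *m z^T = 0.
    by rewrite tauE -!mulmxA -trmx_mul zW trmx0 !mulmx0.
  have tZ t i : tau t *m (row i Z)^T = t 0 i *: q i.
    rewrite tauE -!mulmxA -trmx_mul -row_mul ZW.
    have -> : diag_mx t *m (row i 1%:M)^T = t 0 i *: delta_mx i 0.
      apply/colP => x; rewrite mul_diag_mx !mxE eqxx andbT eq_sym.
      by have [->|_] := eqVneq i x; rewrite ?mulr0.
    by rewrite -scalemxAr -colE; congr (_ *: _); apply/colP => x; rewrite !mxE.
  have t0 t : tau t \in V -> t = 0.
    move=> tV; apply/rowP => i; have := LV i _ tV (tz t).
    rewrite tZ -scalemxAr qE => /matrixP/(_ 0 0); rewrite !mxE mulr1 => ->.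
    by [].
  pose D := (V :&: compspace (1%:M : 'M_m) z)%VS.
  have h1 := dim_cap_compspace (1%:M : 'M_m) z V.
  have h2 := dim_compspace (1%:M : 'M[K]_m) z.
  have h3 : (limg tau <= compspace (1%:M : 'M_m) z)%VS.
    by apply/subvP => _ /memv_imgP[t _ ->]; apply/compspaceP; rewrite mul1mx.
  have h4 : \dim (limg tau) = k.
    rewrite limg_dim_eq; first by rewrite dimvM mul1n.
    apply/eqP; rewrite -subv0; apply/subvP => t; rewrite memv_cap memv_ker memv0.
    by case/andP => _ /eqP h; rewrite (t0 t) // h mem0v.
  have h5 : (D :&: limg tau = 0)%VS.
    apply/eqP; rewrite -subv0; apply/subvP => M; rewrite !memv_cap memv0.
    by case/andP => /andP[MV _] /memv_imgP[t _ ME]; rewrite ME (t0 t) ?linear0 // -ME.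
  have h6 := dimv_disjoint_sum h5.
  have h7 : (\dim (D + limg tau) <= \dim (compspace (1%:M : 'M[K]_m) z))%N.
    by rewrite dimvS // subv_add capvSr.
  rewrite -/D in h1; dlia.
have Qstep k : Q k -> Q k.+1 \/ exists S : 'M_n, [/\ (z <= S)%MS,
    (\rank S <= \rank z + k)%N &
    forall z' : 'rV_n, ~~ (z' <= S)%MS -> transverse V z z'].
  case=> Z [W [L [ZW zW L0 LV]]].
  case: (classic (exists2 z' : 'rV_n, ~~ (z' <= z + Z)%MS & ~ transverse V z z')); last first.
    move=> h; right; exists (z + Z)%MS; split; first exact: addsmxSl.
      by rewrite (leq_trans (mxrank_adds_leqif _ _)) // leq_add2l rank_leq_row.
    by move=> z' z'S; apply: NNPP => ntr; apply: h; exists z'.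
  case=> z' z'S ntr; left.
  have [l nl] := not_all_ex_not _ _ ntr.
  have [lV /eqP l0] := imply_to_and _ _ nl.
  have [w [zw Zw z'w]] : exists w : 'cV_n, [/\ z *m w = 0, Z *m w = 0 & z' *m w = 1%:M].
    move: z'S; rewrite submxE => /matrix0Pn[i [j]]; rewrite ord1 => {i} ne.
    have zS : z *m cokermx (z + Z)%MS = 0 by apply/eqP; rewrite -submxE addsmxSl.
    have ZS : Z *m cokermx (z + Z)%MS = 0 by apply/eqP; rewrite -submxE addsmxSr.
    move: (cokermx _) zS ZS ne => C zS ZS ne.
    exists (((z' *m C) 0 j)^-1 *: col j C).
    rewrite colE -!scalemxAr !mulmxA zS ZS !mul0mx !scaler0; split=> //.
    by rewrite -colE; apply/matrixP => x y; rewrite !ord1 mxE [X in _ * X]mxE mulVf // mxE.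
  rewrite -[k.+1]addn1.
  exists (col_mx Z z'), (row_mx (W - w *m (z' *m W)) w), (col_mx L l); split.
  - rewrite mul_col_row !mulmxBr !mulmxA Zw ZW z'w mul1mx !mul0mx subr0 subrr.
    by rewrite -scalar_mx_block.
  - by rewrite mul_mx_row mulmxBr !mulmxA zw zW !mul0mx subr0 row_mx0.
  - move=> i; case: (split_ordP i) => j ->; first by rewrite rowKu.
    by rewrite rowKd ord1 row_id.
  move=> i M MV Mz; case: (split_ordP i) => j ->.
    by rewrite !rowKu LV.
  by rewrite !rowKd ord1 !row_id lV.
have Q0 : Q 0.
  exists 0, 0, 0; split; rewrite ?mulmx0 //; last by case.
    by apply/matrixP; case.
  by case.
have : forall d k, Q k -> (c = d + k)%N -> exists S : 'M_n, [/\ (z <= S)%MS,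
    (\rank S <= \rank z + c)%N &
    forall z' : 'rV_n, ~~ (z' <= S)%MS -> transverse V z z'].
  elim=> [|d IH] k Qk ck; have [Qk1|[S [zS rS trS]]] := Qstep k Qk.
  - by have := Qbound _ Qk1; lia.
  - by exists S; split=> //; lia.
  - by apply: (IH _ Qk1); lia.
  - by exists S; split=> //; lia.
by move=> /(_ c 0%N Q0); rewrite addn0; apply.
Qed.

End Regular.

(** * Range-compatible maps *)

Section RangeCompatible.
Variable K : fieldType.

Lemma mulmx_trV_eq0 p n (N : 'M[K]_(p, n)) :
  (forall x : 'rV_n, N *m x^T = 0) -> N = 0.
Proof.
move=> h; apply: trmx_inj; apply/row_matrixP => i.
by rewrite trmx0 row0 rowE -[LHS]trmxK trmx_mul trmxK h trmx0.
Qed.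

Lemma mulmx_cV_inj p n (N N' : 'M[K]_(p, n)) :
  (forall q : 'cV_n, N *m q = N' *m q) -> N = N'.
Proof.
move=> h; apply/eqP; rewrite -subr_eq0; apply/eqP/mulmx_trV_eq0 => x.
by rewrite mulmxBl h subrr.
Qed.

Lemma exists_outside n (S : 'M[K]_n) :
  (\rank S < n)%N -> exists y : 'rV_n, ~~ (y <= S)%MS.
Proof.
move=> rS; have : ~~ (1%:M <= S)%MS.
  by apply/negP => /mxrankS; rewrite mxrank1 leqNgt rS.
by move=> /row_subPn[i iS]; exists (row i 1%:M).
Qed.

Lemma eq0_outside p n (S : 'M[K]_n) (N : 'M[K]_(p, n)) : (\rank S < n)%N ->
  (forall y : 'rV_n, ~~ (y <= S)%MS -> N *m y^T = 0) -> N = 0.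
Proof.
move=> /exists_outside[y yS] h; apply: mulmx_trV_eq0 => x.
have [xS|/h//] := boolP (x <= S)%MS.
have xyS : ~~ ((x + y)%R <= S)%MS.
  by apply: contra yS => h'; rewrite -[y](addKr x) addmx_sub // -scaleN1r scalemx_sub.
by have := h _ xyS; rewrite linearD mulmxDr (h _ yS) addr0.
Qed.

(** The pairs (M z^T, M z'^T), for M in V, are arbitrary. *)
Definition pair_onto m n (V : {vspace 'M[K]_(m, n)}) (z z' : 'rV[K]_n) :=
  forall p q : 'cV_m, exists M,
    [/\ M \in V, M *m z^T = p & M *m z'^T = q].

(** A space of matrices with n columns and codimension at most n - 2 has a point z
    that is in general position with each vector outside a proper subspace S. *)
Lemma regular_point m n (V : {vspace 'M[K]_(m, n)}) c :
  (m * n <= \dim V + c)%N -> (c + 2 <= n)%N ->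
  exists z (S : 'M_n), [/\ z != 0, (\rank S < n)%N, (z <= S)%MS &
    forall z' : 'rV_n, ~~ (z' <= S)%MS -> pair_onto V z z'].
Proof.
move=> dimV cn; have [S0 [_ rS0 trS0]] := transverse_exists 0 dimV.
have /exists_outside[z zS0] : (\rank S0 < n)%N.
  by rewrite mxrank0 in rS0; lia.
have trz := transverse_onto (trS0 _ zS0).
have [S [zS rS trS]] := transverse_exists z dimV.
exists z, S; split=> //.
- by apply: contraNneq zS0 => ->; apply: sub0mx.
- by move: (rank_leq_row z); lia.
move=> z' /trS /transverse_onto tr' p q.
have [M1 [M1V _ M1z]] := trz p.
have [M2 [M2V M2z M2z']] := tr' (q - M1 *m z'^T).
exists (M1 + M2); rewrite memvD // !mulmxDl M1z M2z addr0 M2z'.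
by rewrite addrC subrK.
Qed.

(** If, on A, the product M z^T vanishes as soon as its reduction modulo e does,
    and if the reduction of A modulo e has codimension at most n - 2, then the row
    a *m M of M is a fixed combination of the rows of B *m M, which gives the row l
    below. *)
Lemma range_compatible m c (A : {vspace 'M[K]_m.+1}) e a Y B :
  frame e a Y B ->
  (m * m.+1 <= \dim (sandwich B (1%:M : 'M_m.+1) @: A) + c)%N ->
  (c + 2 <= m.+1)%N ->
  (forall M (z : 'rV_m.+1), M \in A -> B *m M *m z^T = 0 -> M *m z^T = 0) ->
  exists2 l : 'rV_m.+1, l != 0 & forall M, M \in A -> l *m M = 0.
Proof.
move=> F dimA cm RC.
have [z [S [z0 rS zS onto]]] := regular_point dimA cm.
have ontoA z' (p q : 'cV_m) : ~~ (z' <= S)%MS ->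
    exists M, [/\ M \in A, B *m M *m z^T = p & B *m M *m z'^T = q].
  move=> /onto/(_ p q)[_ [/memv_imgP[M MA ->]]].
  by rewrite sandwichE trmx1 mulmx1 => Mz Mz'; exists M.
have fac x : (forall p : 'cV_m, exists2 M, M \in A & B *m M *m x^T = p) ->
    exists u : 'M_(1, m), forall M, M \in A -> a *m M *m x^T = u *m (B *m M *m x^T).
  move=> on; have [||u uE] := @factor_through K _ _ _ A (sandwich B x) (sandwich a x).
  - by move=> p; have [M MA Mp] := on p; exists M; rewrite ?sandwichE.
  - by move=> M MA; rewrite !sandwichE -!mulmxA => h; rewrite RC ?mulmx0 -?mulmxA.
  by exists u => M MA; rewrite -!sandwichE uE.
have [y yS] := exists_outside rS.
have [|u uE] := fac z.
  by move=> p; have [M [MA Mz _]] := ontoA y p 0 yS; exists M.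
exists (a - u *m B).
  have [ea Be _ _ _] := F; apply/negP => /eqP/(congr1 (mulmx^~ e^T)).
  rewrite mulmxBl -mulmxA Be mulmx0 subr0 mul0mx => ae.
  move/(congr1 trmx): ea; rewrite trmx_mul trmxK ae trmx1.
  by move/matrixP/(_ 0 0)/eqP; rewrite !mxE eqxx eq_sym oner_eq0.
move=> M0 M0A; apply: (eq0_outside rS) => z' z'S.
have [|u' u'E] := fac z'.
  by move=> q; have [M [MA _ Mz']] := ontoA z' 0 q z'S; exists M.
have zz'S : ~~ ((z + z')%R <= S)%MS.
  by apply: contra z'S => h'; rewrite -[z'](addKr z) addmx_sub // -scaleN1r scalemx_sub.
have [|u2 u2E] := fac (z + z').
  by move=> q; have [M [MA _ Mz']] := ontoA _ 0 q zz'S; exists M.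
have sum M : M \in A ->
    u2 *m (B *m M *m z^T) + u2 *m (B *m M *m z'^T) =
    u *m (B *m M *m z^T) + u' *m (B *m M *m z'^T).
  move=> MA; rewrite -uE // -u'E // -!mulmxDr -linearD /= -u2E //.
(* The row u is the same for all z' outside S, hence for all vectors. *)
have u2u : u2 = u.
  apply: mulmx_cV_inj => q; have [M [MA Mz Mz']] := ontoA z' q 0 z'S.
  by have := sum M MA; rewrite Mz Mz' !mulmx0 !addr0.
have u2u' : u2 = u'.
  apply: mulmx_cV_inj => q; have [M [MA Mz Mz']] := ontoA z' 0 q z'S.
  by have := sum M MA; rewrite Mz Mz' !mulmx0 !add0r.
rewrite mulmxBl mulmxBl u'E // -u2u' u2u -!mulmxA subrr //.
Qed.

End RangeCompatible.

(** * Dieudonné's theorem: the case of equality *)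

Section Transpose.
Variable K : fieldType.

(** The space of the transposes of the elements of A. *)
Definition trv m n (A : {vspace 'M[K]_(m, n)}) : {vspace 'M[K]_(n, m)} :=
  (linfun (@trmx K m n) @: A)%VS.

Lemma mem_trv m n (A : {vspace 'M[K]_(m, n)}) M : (M \in trv A) = (M^T \in A).
Proof.
apply/memv_imgP/idP => [[N NA ->]|MA]; first by rewrite lfunE /= trmxK.
by exists M^T; rewrite ?lfunE /= ?trmxK.
Qed.

Lemma dim_trv m n (A : {vspace 'M[K]_(m, n)}) : \dim (trv A) = \dim A.
Proof.
apply: limg_dim_eq; apply/eqP; rewrite -subv0; apply/subvP => M.
rewrite memv_cap memv_ker memv0 lfunE /= => /andP[_ /eqP h].
by rewrite -[M]trmxK h trmx0.
Qed.

End Transpose.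

Section Dieudonne.
Variable K : fieldType.

(** Every nonzero e is the left factor of a rank one element e^T w of A. *)
Definition rank1_cols n (A : {vspace 'M[K]_n}) := forall e : 'rV[K]_n,
  e != 0 -> exists2 w : 'rV[K]_n, w != 0 & e^T *m w \in A.
(** Every nonzero w is the right factor of a rank one element e^T w of A. *)
Definition rank1_rows n (A : {vspace 'M[K]_n}) := forall w : 'rV[K]_n,
  w != 0 -> exists2 e : 'rV[K]_n, e != 0 & e^T *m w \in A.

Lemma rank1_cols_trv n (A : {vspace 'M[K]_n}) :
  rank1_cols A <-> rank1_rows (trv A).
Proof.
by split=> h e /h[w w0 ewA]; exists w => //; move: ewA; rewrite mem_trv trmx_mul trmxK.
Qed.

Lemma rank1_rows_trv n (A : {vspace 'M[K]_n}) :
  rank1_rows A <-> rank1_cols (trv A).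
Proof.
by split=> h e /h[w w0 ewA]; exists w => //; move: ewA; rewrite mem_trv trmx_mul trmxK.
Qed.

(** If the reduction B X modulo e kills z and has full rank m, then z spans its
    kernel, which contains the kernel of the singular matrix X. *)
Lemma kernel_point m (X : 'M[K]_m.+1) (B Y' B' : 'M_(m, m.+1)) z a' :
  frame z a' Y' B' -> X \notin unitmx -> B *m X *m z^T = 0 ->
  B *m X *m Y'^T \in unitmx -> X *m z^T = 0.
Proof.
move=> F /ker_of_nonunitmx[x x0 Xx] BXz Nu.
have xE := frame_dec x F.
have B'x : B' *m x^T = 0.
  have /(unitmx_ker Nu) : B *m X *m Y'^T *m ((B' *m x^T)^T)^T = 0.
    rewrite trmxK -mulmxA; move/(congr1 (mulmx (B *m X))): xE.
    by rewrite mulmxDr [in X in _ = X + _]mulmxA BXz mul0mx add0r -mulmxA Xx mulmx0.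
  by move/(congr1 trmx); rewrite trmxK trmx0.
move: xE; rewrite B'x mulmx0 addr0 [a' *m x^T]mx11_scalar mul_mx_scalar.
move: (_ 0 0) => s xE; have s0 : s != 0.
  apply: contraNneq x0 => s0; rewrite s0 scale0r in xE.
  by rewrite -[x]trmxK xE trmx0.
move: Xx; rewrite xE -scalemxAr => /eqP; rewrite scaler_eq0 (negPf s0).
by move/eqP.
Qed.

(** The case of equality in Dieudonné's theorem when A contains no nonzero e^T w
    for some e: then p + A is the graph of an affine map that gives one row of a
    matrix in terms of the others, and this row always lies in the span of the
    others. *)
Lemma nonunit_graph m (p : 'M[K]_m.+1) (A : {vspace 'M[K]_m.+1}) e :
  e != 0 -> (forall w : 'rV_m.+1, e^T *m w \in A -> w = 0) ->
  (m * m.+1 <= \dim A)%N ->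
  (forall M, M \in A -> p + M \notin unitmx) ->
  [\/ m != 1%N, exists2 t : K, t != 0 & t != 1 | rank1_rows A] ->
  exists2 l : 'rV_m.+1, l != 0 & forall M, M \in A -> l *m (p + M) = 0.
Proof.
move=> e0 eA dimA sing gen.
have [m0|m_gt0] := posnP m.
  have dA := dieudonne sing; have A0 : A = 0%VS.
    by apply/eqP; rewrite -dimv_eq0; subst m; dlia.
  have : p^T \notin unitmx by have := sing 0 (mem0v _); rewrite addr0 unitmx_tr.
  case/ker_of_nonunitmx => l l0 pl; exists l => // M.
  rewrite A0 memv0 => /eqP ->; rewrite addr0.
  by apply: trmx_inj; rewrite trmx_mul pl trmx0.
have [a [Y [B Fe]]] := exists_frame e0.
have injB M : M \in A -> B *m M = 0 -> M = 0.
  move=> MA BM; have ME := frame_rank1 Fe BM.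
  by rewrite ME (eA (a *m M)) ?mulmx0 // -ME.
have injBV M M' : M \in A -> M' \in A -> B *m M = B *m M' -> M = M'.
  move=> MA MA' h; apply/eqP; rewrite -subr_eq0; apply/eqP/injB.
    exact: memvB.
  by rewrite mulmxBr h subrr.
have imB : \dim (sandwich B (1%:M : 'M[K]_m.+1) @: A) = \dim A.
  apply: limg_dim_eq; apply/eqP; rewrite -subv0; apply/subvP => M.
  rewrite memv_cap memv_ker memv0 sandwichE trmx1 mulmx1 => /andP[MA /eqP BM].
  by rewrite (injB M).
have ontoB R : exists2 M, M \in A & B *m M = R.
  have : R \in (sandwich B (1%:M : 'M[K]_m.+1) @: A)%VS.
    suff -> : (sandwich B (1%:M : 'M[K]_m.+1) @: A)%VS = fullv by rewrite memvf.
    by apply/eqP; rewrite eqEdim subvf /= dimvM; dlia.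
  by case/memv_imgP => M MA ->; exists M; rewrite ?sandwichE ?trmx1 ?mulmx1.
have [M1 M1A BM1] := ontoB (- (B *m p)).
have Bp : B *m (p + M1) = 0 by rewrite mulmxDr BM1 subrr.
have point M (z a' : 'rV_m.+1) Y' B' : frame z a' Y' B' -> M \in A ->
    B *m M *m z^T = 0 -> B *m M *m Y'^T \in unitmx -> (p + M1) *m z^T + M *m z^T = 0.
  move=> Fz MA BMz Nu; rewrite -mulmxDl; apply: (@kernel_point _ _ B _ _ _ _ Fz).
  - by rewrite -addrA sing // memvD.
  - by rewrite mulmxDr Bp add0r.
  - by rewrite mulmxDr Bp add0r.
have lineE (v : 'cV_m.+1) : B *m v = 0 -> v = (a *m v) 0 0 *: e^T.
  by move=> /(frame_rank1 Fe) {1}->; rewrite {1}[a *m v]mx11_scalar mul_mx_scalar.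
have RC M (z : 'rV_m.+1) : M \in A -> B *m M *m z^T = 0 -> M *m z^T = 0.
  have [->|z0] := eqVneq z 0; first by rewrite trmx0 !mulmx0.
  have [a' [Y' [B' Fz]]] := exists_frame z0.
  move=> MA BMz; have := lineE (M *m z^T); rewrite mulmxA => /(_ BMz).
  set s := (_ 0 0) => Mz; apply/eqP; apply/negPn/negP => Mz0.
  have s0 : s != 0 by apply: contraNneq Mz0 => s0; rewrite Mz s0 scale0r.
  have := lineE ((p + M1) *m z^T); rewrite mulmxA Bp mul0mx => /(_ erefl).
  set al := (_ 0 0) => pz.
  have et0 : e^T != 0 by apply: contraNneq e0 => h; rewrite -[e]trmxK h trmx0.
  have injN M' : M' \in A -> B *m M' *m z^T = 0 -> B *m M' *m Y'^T = 0 -> M' = 0.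
    move=> MA' h h'; apply: injB => //; apply: trmx_inj; rewrite trmx0.
    apply: trmx_inj; rewrite trmx0 trmxK; apply: mulmx_trV_eq0 => x.
    by rewrite (frame_dec x Fz) mulmxDr !mulmxA h h' !mul0mx addr0.
  have [m1|m1] := eqVneq m 1%N; last first.
    pose A2 := ((A :&: compspace B z) :&: compspace a z)%VS.
    (* The scalar be is chosen so that (p + M1 + be *: M) z^T is e^T, hence nonzero;
       the reductions of the matrices with this property are then all singular,
       although they form an affine space of codimension 1. *)
    pose be := (1 - al) / s.
    have A2P M' : M' \in A2 -> [/\ M' \in A, B *m M' *m z^T = 0 & M' *m z^T = 0].
      rewrite memv_cap => /andP[]; rewrite memv_cap => /andP[-> /compspaceP h] /compspaceP h'.
      by split=> //; rewrite (lineE (M' *m z^T)) mulmxA ?h' ?mxE ?scale0r.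
    have : (\dim (sandwich B Y' @: A2) + m <= m * m)%N.
      apply: (@dieudonne K m (sandwich B Y' (be *: M))).
      move=> _ /memv_imgP[M' /A2P[MA' BM' Mz'] ->]; apply/negP.
      rewrite -linearD /= sandwichE => Nu.
      have Bz0 : B *m (be *: M + M') *m z^T = 0.
        by rewrite mulmxDr mulmxDl -scalemxAr -scalemxAl BMz BM' scaler0 addr0.
      have := point _ _ _ _ _ Fz (memvD (memvZ be MA) MA') Bz0 Nu.
      rewrite pz mulmxDl Mz' addr0 -scalemxAl Mz scalerA => /eqP.
      by rewrite -scalerDl divfK // addrC subrK scale1r (negPf et0).
    have := dim_cap_compspace B z A; have := dim_cap_compspace a z (A :&: compspace B z).
    rewrite (frame_free Fe) !rank_rV z0 -/A2.
    have : \dim (sandwich B Y' @: A2) = \dim A2.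
      apply: limg_dim_eq; apply/eqP; rewrite -subv0; apply/subvP => M'.
      rewrite memv_cap memv_ker memv0 sandwichE => /andP[/A2P[h1 h2 _] /eqP h3].
      by rewrite (injN M').
    by case: (a != 0); dlia.
  case: gen => [|[t t0 t1]|rows]; first by rewrite m1.
    (* For m = 1 the reduction is a scalar, and a value of be other than 0 and
       - al / s is needed: the field must have a third element. *)
    have [be be0 bes] : exists2 be, be != 0 & al + be * s != 0.
      have [h|h] := eqVneq (al + s) 0; last by exists 1; rewrite ?oner_neq0 ?mul1r.
      exists t => //; have -> : al = - s by apply/eqP; rewrite -addr_eq0 h.
      by rewrite addrC -{2}[s]mul1r -mulrBl mulf_neq0 // subr_eq0.
    have Bz0 : B *m (be *: M) *m z^T = 0.
      by rewrite -scalemxAr -scalemxAl BMz scaler0.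
    have := point _ _ _ _ _ Fz (memvZ be MA) Bz0.
    rewrite -scalemxAl Mz pz scalerA -scalerDl -scalemxAr -scalemxAl.
    case: (boolP (be *: (B *m M *m Y'^T) \in unitmx)) => [_ /(_ isT) /eqP|].
      by rewrite scaler_eq0 (negPf bes) (negPf et0).
    move=> Nu _; case/negP: Nu.
    have : B *m M *m Y'^T != 0.
      by apply: contraNneq Mz0 => h; rewrite (injN M) // mul0mx.
    move: (B *m M *m Y'^T); clear -m1 be0; subst m => N N0.
    rewrite [N]mx11_scalar scale_scalar_mx unitmxE det_scalar1 unitfE mulf_neq0 //.
    by apply: contraNneq N0 => h; rewrite [N]mx11_scalar h raddf0.
  clear point; subst m; pose w := B *m M.
  have w0 : w != 0 by apply: contraNneq Mz0 => /injB -> //; rewrite mul0mx.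
  have [c c0 cwA] := rows w w0.
  have := mx11_scalar (B *m c^T); set k := (_ 0 0) => Bc.
  have k0 : k != 0.
    apply: contraNneq Mz0 => k0; have := injB _ cwA.
    rewrite mulmxA Bc k0 raddf0 mul0mx => /(_ erefl) cw.
    have [i ci] : exists i, c 0 i != 0.
      by case/matrix0Pn: c0 => i0 [i]; rewrite ord1; exists i.
    have : c 0 i *: w = 0.
      move/(congr1 (row i)): cw; rewrite row_mul row0 => <-.
      by rewrite [row i _]mx11_scalar mul_scalar_mx !mxE.
    by move/eqP; rewrite scaler_eq0 (negPf ci) (negPf w0).
  have ME : M = k^-1 *: (c^T *m w).
    apply: injBV => //; first by rewrite memvZ.
    by rewrite -scalemxAr mulmxA Bc mul_scalar_mx scalerA mulVf // scale1r.
  by case/eqP: Mz0; rewrite ME -scalemxAl -mulmxA /w BMz mulmx0 scaler0.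
(* The affine space p + A contains 0. *)
have pE : p = - M1.
  apply/eqP; rewrite -addr_eq0; apply/eqP/mulmx_trV_eq0 => z.
  have [->|z0] := eqVneq z 0; first by rewrite trmx0 !mulmx0.
  have [a' [Y' [B' Fz]]] := exists_frame z0; have [_ B'z _ B'Y _] := Fz.
  have [M MA BM] := ontoB B'.
  have := point M _ _ _ _ Fz MA; rewrite BM B'z B'Y unitmx1 => /(_ erefl isT).
  by rewrite (RC M) ?addr0 // BM.
have [l l0 lA] : exists2 l : 'rV_m.+1, l != 0 & forall M, M \in A -> l *m M = 0.
  by apply: (range_compatible (c := 0) Fe) => //; rewrite ?imB; dlia.
by exists l => // M MA; rewrite pE addrC lA // memvB.
Qed.

End Dieudonne.

Section DieudonneEquality.
Variable K : fieldType.

(** The cross of e^T w is the space of the M whose reduction modulo e and restriction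
    to the kernel of w is zero, namely compspace B B'; its dimension is 2m + 1. *)
Lemma dim_cross_cap m (p : 'M[K]_m.+1) (A : {vspace 'M[K]_m.+1}) e a Y B w a' Y' B' :
  frame e a Y B -> frame w a' Y' B' -> e^T *m w \in A ->
  (forall M, M \in A -> p + M \notin unitmx) ->
  (\dim A + m <= \dim (A :&: compspace B B') + m * m)%N.
Proof.
move=> Fe Fw ewA sing; have := limg_ker_dim (sandwich B B') A.
have : (\dim (sandwich B B' @: A) + m <= m * m)%N.
  apply: (@dieudonne K m (sandwich B B' p)) => _ /memv_imgP[M MA ->].
  rewrite -linearD /= sandwichE; apply: (cross_nonunit Fe Fw (sing _ MA)).
  by rewrite -addrA sing // memvD.
rewrite /compspace; dlia.
Qed.

(** The cross of each rank one element of A meets A in codimension at most 1. *)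
Definition large_crosses m (A : {vspace 'M[K]_m.+1}) :=
  forall e a Y B w a' Y' B', frame e a Y B -> frame w a' Y' B' ->
  e^T *m w \in A -> (2 * m <= \dim (A :&: compspace B B'))%N.

Lemma large_crosses_trv m (A : {vspace 'M[K]_m.+1}) :
  large_crosses A -> large_crosses (trv A).
Proof.
move=> lA e a Y B w a' Y' B' Fe Fw; rewrite mem_trv trmx_mul trmxK => ewA.
have := lA _ _ _ _ _ _ _ _ Fw Fe ewA; rewrite -dim_trv => h.
apply: leq_trans h _; apply: dimvS; apply/subvP => M.
rewrite mem_trv => /memv_capP[MA /compspaceP h]; apply/memv_capP; split.
  by rewrite mem_trv.
by apply/compspaceP/trmx_inj; rewrite !trmx_mul trmxK trmx0 mulmxA.
Qed.

(** When the crosses are large and e^T w is not in A, the w' with e^T w' in A form a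
    hyperplane. *)
Lemma cols_nearly_full m (A : {vspace 'M[K]_m.+1}) (e w : 'rV_m.+1) :
  large_crosses A -> rank1_cols A -> e^T *m w \notin A ->
  forall w' : 'rV_m.+1, e^T *m w' \in (A + <[e^T *m w]>)%VS.
Proof.
move=> large cols ewA w'.
have e0 : e != 0.
  by apply: contraNneq ewA => ->; rewrite trmx0 mul0mx mem0v.
have [w1 w10 ew1A] := cols e e0.
have [a [Y [B Fe]]] := exists_frame e0; have [a' [Y' [B' Fw]]] := exists_frame w10.
have d1 := large _ _ _ _ _ _ _ _ Fe Fw ew1A.
pose E := compspace B (1%:M : 'M[K]_m.+1).
have Be : B *m e^T = 0 by case: Fe.
have eE (v : 'rV_m.+1) : e^T *m v \in E by apply/compspaceP; rewrite mulmxA Be !mul0mx.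
have dE := dim_compspace B (1%:M : 'M[K]_m.+1).
have dC := dim_compspace B B'.
rewrite (frame_free Fe) ?(frame_free Fw) ?mxrank1 -/E in dE dC.
have EC : (E <= compspace B B')%VS.
  by apply/subvP => M /compspaceP; rewrite trmx1 mulmx1 => h; apply/compspaceP; rewrite h mul0mx.
have d2 := dimv_sum_cap (A :&: compspace B B') E.
have d3 : (\dim (A :&: compspace B B' + E) <= \dim (compspace B B'))%N.
  by rewrite dimvS // subv_add capvSr.
have d4 : (\dim (A :&: compspace B B' :&: E) <= \dim (A :&: E))%N.
  by rewrite dimvS // capvS // capvSl.
have sub : (E <= A :&: E + <[e^T *m w]>)%VS.
  have d5 : (A :&: E :&: <[e^T *m w]> = 0)%VS.
    apply/eqP; rewrite -subv0; apply/subvP => M; rewrite memv_cap.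
    case/andP => MAE /vlineP[k ME]; rewrite memv0 ME.
    have [->|k0] := eqVneq k 0; first by rewrite scale0r.
    case/negP: ewA; move: MAE; rewrite memv_cap ME => /andP[kA _].
    by rewrite -[_ *m _]scale1r -(mulVf k0) -scalerA memvZ.
  have d6 := dimv_disjoint_sum d5.
  have d7 : \dim <[e^T *m w]> = 1%N.
    rewrite dim_vline; case: eqP => // h.
    by case/negP: ewA; rewrite h mem0v.
  suff -> : (A :&: E + <[e^T *m w]> = E)%VS by [].
  apply/eqP; rewrite eqEdim subv_add capvSr -memvE eE /=.
  rewrite d6 d7; dlia.
by apply: (subvP (addvS (capvSl A E) (subvv _))); apply: (subvP sub).
Qed.

Lemma nonunit_trv n (p : 'M[K]_n) (A : {vspace 'M[K]_n}) :
  (forall M, M \in A -> p + M \notin unitmx) ->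
  forall M, M \in trv A -> p^T + M \notin unitmx.
Proof.
move=> sing M; rewrite mem_trv => /sing; rewrite -unitmx_tr.
by rewrite linearD /= trmxK.
Qed.

Lemma rows_nearly_full m (A : {vspace 'M[K]_m.+1}) (e w : 'rV_m.+1) :
  large_crosses A -> rank1_rows A -> e^T *m w \notin A ->
  forall e' : 'rV_m.+1, e'^T *m w \in (A + <[e^T *m w]>)%VS.
Proof.
move=> large rows ewA e'.
have := @cols_nearly_full _ (trv A) w e; rewrite mem_trv trmx_mul trmxK.
move=> /(_ (large_crosses_trv large) (proj1 (rank1_rows_trv A) rows) ewA e').
move=> /memv_addP[N NA [_ /vlineP[k ->] h]]; apply/memv_addP.
exists N^T; first by rewrite -mem_trv.
exists (k *: (e^T *m w)); first by rewrite memvZ // memv_line.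
move/(congr1 trmx): h; rewrite linearD linearZ /= !trmx_mul !trmxK.
by [].
Qed.

(** If A has large crosses and rank one elements in all directions, then it has
    codimension at most 1: adjoining to A one rank one
    matrix outside A yields all rank one matrices. *)
Lemma large_crosses_nearly_full m (A : {vspace 'M[K]_m.+1}) :
  large_crosses A -> rank1_cols A -> rank1_rows A ->
  (m.+1 * m.+1 <= \dim A + 1)%N.
Proof.
move=> large cols rows.
have [Afull|] := classic (forall e w : 'rV[K]_m.+1, e^T *m w \in A).
  by rewrite (rank1_span Afull) dimvM leq_addr.
move=> nfull; have [e1 ne1] := not_all_ex_not _ _ nfull.
have [w /negP e1wA] := not_all_ex_not _ _ ne1.
pose A1 := (A + <[e1^T *m w]>)%VS.
have key (e w' : 'rV_m.+1) : e^T *m w \notin A -> e^T *m w' \in A1.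
  move=> ewA; have := cols_nearly_full large cols ewA w'.
  apply/subvP; rewrite subv_add addvSl -memvE.
  exact: rows_nearly_full large rows e1wA e.
have A1f : A1 = fullv.
  apply: rank1_span => e w'; have [ewA|/key//] := boolP (e^T *m w \in A).
  have -> : e^T *m w' = (e1 + e)^T *m w' - e1^T *m w'.
    by rewrite linearD mulmxDl addrAC subrr add0r.
  rewrite memvB ?key //; apply: contra e1wA => h.
  rewrite (_ : e1^T *m w = (e1 + e)^T *m w - e^T *m w) ?memvB //.
  by rewrite linearD mulmxDl addrK.
have := dimv_add_leqif A <[e1^T *m w]>%VS; rewrite -/A1 A1f dimvM => -[h _].
by move: h; rewrite dim_vline; case: (_ != 0); dlia.
Qed.

Lemma nonunit_no_cols_rows m (p : 'M[K]_m.+1) (A : {vspace 'M[K]_m.+1}) :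
  (0 < m)%N -> (m * m.+1 <= \dim A)%N ->
  (forall M, M \in A -> p + M \notin unitmx) ->
  rank1_cols A -> rank1_rows A -> False.
Proof.
move=> m_gt0 dimA sing cols rows.
have D := dieudonne sing.
have large : large_crosses A.
  move=> e a Y B w a' Y' B' Fe Fw ewA.
  by have := dim_cross_cap Fe Fw ewA sing; dlia.
by have := large_crosses_nearly_full large cols rows; dlia.
Qed.

(** An affine space of singular matrices with codimension n consists of the matrices
    with a given vector in their right kernel, or in their left kernel. This fails
    for n = 2 over the field with two elements, where the affine space of the
    matrices [a, 0; b, a + 1] is singular; hence the third hypothesis. *)
Theorem dieudonne_eq n (p : 'M[K]_n) (A : {vspace 'M[K]_n}) :
  (n * n <= \dim A + n)%N ->
  (forall M, M \in A -> p + M \notin unitmx) ->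
  [\/ n != 2%N, exists2 t : K, t != 0 & t != 1 | rank1_rows A] ->
  (exists2 x : 'rV_n, x != 0 & forall M, M \in A -> (p + M) *m x^T = 0) \/
  (exists2 l : 'rV_n, l != 0 & forall M, M \in A -> l *m (p + M) = 0).
Proof.
case: n p A => [|m] p A dimA sing gen.
  have := sing 0 (mem0v A); rewrite unitmxE det_mx00 unitr1 //.
have dimA' : (m * m.+1 <= \dim A)%N by dlia.
have [cols|] := classic (rank1_cols A); last first.
  move=> nc; have [e ne] := not_all_ex_not _ _ nc; have [e0 eA] := imply_to_and _ _ ne; right.
  apply: (nonunit_graph e0) => // w ewA; apply/eqP.
  by apply: contra_notT eA => w0; exists w.
have [rows|norows] := classic (rank1_rows A).
  have [m0|m_gt0] := posnP m.
    have D := dieudonne sing; have A0 : A = 0%VS.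
      by apply/eqP; rewrite -dimv_eq0; subst m; dlia.
    have [|w w0] := cols (const_mx 1).
      by apply/eqP => /matrixP/(_ 0 0)/eqP; rewrite !mxE oner_eq0.
    rewrite A0 memv0 => /eqP h; case/eqP: w0.
    have := congr1 (mulmx (delta_mx 0 0 : 'rV_m.+1)) h.
    rewrite mulmxA mulmx0 [X in X *m _]mx11_scalar !mxE (bigD1 0) //= big1.
      by rewrite !mxE eqxx mulr1 addr0 mul_scalar_mx scale1r.
    by move=> i /negPf i0; rewrite !mxE i0 mul0r.
  by case: (nonunit_no_cols_rows m_gt0 dimA' sing cols rows).
left; have [w nw] := not_all_ex_not _ _ norows.
have [w0 wA] := imply_to_and _ _ nw.
have [||||l l0 lA] := @nonunit_graph _ m p^T (trv A) w w0.
- move=> e; rewrite mem_trv trmx_mul trmxK => ewA; apply/eqP.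
  by apply: contra_notT wA => e0; exists e.
- by rewrite dim_trv.
- exact: nonunit_trv.
- case: gen => [m1|t|rows]; [by constructor 1|by constructor 2|].
  by case: wA; apply: rows.
exists l => // M MA; apply: trmx_inj; rewrite trmx_mul trmxK trmx0 linearD.
by rewrite lA // mem_trv trmxK.
Qed.

End DieudonneEquality.

(** * Large singular spaces without rank one matrices in some direction *)

Section Singular.
Variable K : fieldType.

(** A is contained in a compression space with rank U + rank X = n + 1, the least
    value that forces all its elements to be singular. *)
Definition compressible n (A : {vspace 'M[K]_n}) : Prop :=
  exists p q (U : 'M[K]_(p, n)) (X : 'M[K]_(q, n)),
    (\rank U + \rank X = n.+1)%N /\ (A <= compspace U X)%VS.

Definition singular_space n (A : {vspace 'M[K]_n}) :=
  forall M, M \in A -> M \notin unitmx.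

(** The dimension of the space given by M X1^T = 0 and U M X2^T = 0. *)
Lemma dim_compspace_cap m n p q1 q2 (U : 'M[K]_(p, m)) (X1 : 'M_(q1, n)) (X2 : 'M_(q2, n)) :
  (X1 <= X2)%MS ->
  (\dim (compspace (1%:M : 'M[K]_m) X1 :&: compspace U X2)
     + \rank U * (\rank X2 - \rank X1) + m * \rank X1 = m * n)%N.
Proof.
move=> X12; pose Y1 := <<X1>>%MS; pose X' := (X2 :\: Y1)%MS.
pose f := sandwich U X'; pose C := compspace (1%:M : 'M[K]_m) X1.
have Y1E : (Y1 :=: X1)%MS by apply: genmxE.
have Y12 : (Y1 <= X2)%MS by rewrite Y1E.
have capE : (X2 :&: Y1 :=: X1)%MS by apply: eqmx_trans Y1E; apply/capmx_idPr.
have rX' : \rank X' = (\rank X2 - \rank X1)%N.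
  by have := mxrank_cap_compl X2 Y1; rewrite capE -/X' => <-; rewrite addKn.
have disj : (X' :&: Y1 = 0)%MS by apply: capmx_diff.
pose P := proj_mx X' Y1.
have PX1 : X1 *m P = 0 by apply: proj_mx_0; rewrite // Y1E.
have PX' : X' *m P = X' by apply: proj_mx_id.
have sum : (X2 <= X' + X1)%MS.
  rewrite -(addsmx_diff_cap_eq X2 Y1) -/X'.
  by rewrite addsmxS // capE.
have X'2 : (X' <= X2)%MS by apply: diffmxSl.
have CP M : M \in C -> M *m X1^T = 0 by move/compspaceP; rewrite mul1mx.
have capC : (C :&: compspace U X2 = C :&: lker f)%VS.
  apply/vspaceP => M; rewrite !memv_cap; case: (boolP (M \in C)) => //= /CP MX1.
  apply/compspaceP/compspaceP => h.
    by case/submxP: X'2 => D ->; rewrite trmx_mul mulmxA h mul0mx.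
  case/sub_addsmxP: sum => D ->; rewrite linearD /= mulmxDr !trmx_mul !mulmxA h mul0mx.
  by rewrite -[U *m M *m _]mulmxA MX1 mulmx0 mul0mx addr0.
have im : (f @: C)%VS = limg f.
  apply: subv_anti; rewrite limgS ?subvf //=; apply/subvP => N /memv_imgP[M _ ->].
  apply/memv_imgP; exists (M *m P^T).
    by apply/compspaceP; rewrite mul1mx -mulmxA -trmx_mul PX1 trmx0 mulmx0.
  by rewrite !sandwichE -!mulmxA -trmx_mul PX'.
have := limg_ker_dim f C; rewrite -capC im dim_limg_sandwich rX'.
have := dim_compspace (1%:M : 'M[K]_m) X1; rewrite mxrank1 -/C; dlia.
Qed.


(** In the case of equality, an affine space of singular matrices is linear. *)
Lemma linear_nonunit_pencil m (A : {vspace 'M[K]_m}) (N0 : 'M_m) :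
  (m * m <= \dim A + m)%N ->
  (forall N, N \in A -> N0 + N \notin unitmx) ->
  m != 2%N \/ (exists2 t : K, t != 0 & t != 1) -> N0 \in A.
Proof.
move=> dimA sing gen.
have [|[x x0 h]|[l l0 h]] := dieudonne_eq dimA sing.
- by case: gen => [m2|t]; [constructor 1|constructor 2].
- have sub : (A <= compspace (1%:M : 'M_m) x)%VS.
    apply/subvP => N NA; apply/compspaceP; rewrite mul1mx.
    have := h N NA; have := h 0 (mem0v A); rewrite addr0 mulmxDl => -> .
    by rewrite add0r.
  have -> : A = compspace (1%:M : 'M_m) x.
    apply/eqP; rewrite eqEdim sub /=; have := dim_compspace (1%:M : 'M[K]_m) x.
    rewrite mxrank1 rank_rV x0; dlia.
  by apply/compspaceP; have := h 0 (mem0v A); rewrite addr0 mul1mx.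
have sub : (A <= compspace l (1%:M : 'M_m))%VS.
  apply/subvP => N NA; apply/compspaceP; rewrite trmx1 mulmx1.
  have := h N NA; have := h 0 (mem0v A); rewrite addr0 mulmxDr => -> .
  by rewrite add0r.
have -> : A = compspace l (1%:M : 'M_m).
  apply/eqP; rewrite eqEdim sub /=; have := dim_compspace l (1%:M : 'M[K]_m).
  rewrite mxrank1 rank_rV l0; dlia.
by apply/compspaceP; have := h 0 (mem0v A); rewrite addr0 trmx1 mulmx1.
Qed.

(** A large singular space that contains no nonzero e^T w for some e has a common
    left kernel. *)
Lemma singular_missing_col m (A : {vspace 'M[K]_m.+1}) e :
  singular_space A -> (m * m < \dim A)%N ->
  m != 2%N \/ (exists2 t : K, t != 0 & t != 1) ->
  e != 0 -> (forall w : 'rV_m.+1, e^T *m w \in A -> w = 0) ->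
  exists2 l : 'rV_m.+1, l != 0 & forall M, M \in A -> l *m M = 0.
Proof.
move=> sing dimA gen e0 eA.
have D : (\dim A + m.+1 <= m.+1 * m.+1)%N.
  by apply: (@dieudonne K _ 0) => M /sing; rewrite add0r.
have [a [Y [B Fe]]] := exists_frame e0.
have injB M : M \in A -> B *m M = 0 -> M = 0.
  move=> MA BM; have ME := frame_rank1 Fe BM.
  by rewrite ME (eA (a *m M)) ?mulmx0 // -ME.
have imB : \dim (sandwich B (1%:M : 'M[K]_m.+1) @: A) = \dim A.
  apply: limg_dim_eq; apply/eqP; rewrite -subv0; apply/subvP => M.
  rewrite memv_cap memv_ker memv0 sandwichE trmx1 mulmx1 => /andP[MA /eqP BM].
  by rewrite (injB M).
apply: (range_compatible (c := m.-1) Fe); rewrite ?imB; [dlia|dlia|].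
move=> M0 z M0A BM0z; have [->|z0] := eqVneq z 0; first by rewrite trmx0 mulmx0.
have [a' [Y' [B' Fz]]] := exists_frame z0.
apply/eqP/negPn/negP => M0z.
pose A2 := ((A :&: compspace B z) :&: compspace a z)%VS.
have A2P M : M \in A2 -> [/\ M \in A, B *m M *m z^T = 0 & M *m z^T = 0].
  rewrite memv_cap => /andP[]; rewrite memv_cap => /andP[-> /compspaceP h] /compspaceP h'.
  by split=> //; rewrite (frame_rank1 Fe (M := M *m z^T)) 1?[a *m _]mulmxA ?h' ?mulmx0 // mulmxA.
have injN M : M \in A -> B *m M *m z^T = 0 -> B *m M *m Y'^T = 0 -> M = 0.
  move=> MA h h'; apply: injB => //; apply: mulmx_trV_eq0 => x.
  by rewrite (frame_dec x Fz) mulmxDr !mulmxA h h' !mul0mx addr0.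
(* The affine space of the reductions of the M0 + M, for M in A2, consists of
   singular matrices: an invertible reduction would give M0 z = 0. *)
have : sandwich B Y' M0 \in (sandwich B Y' @: A2)%VS.
  apply: linear_nonunit_pencil gen.
    have := dim_cap_compspace B z A; have := dim_cap_compspace a z (A :&: compspace B z).
    rewrite (frame_free Fe) !rank_rV z0 -/A2.
    have : \dim (sandwich B Y' @: A2) = \dim A2.
      apply: limg_dim_eq; apply/eqP; rewrite -subv0; apply/subvP => M.
      rewrite memv_cap memv_ker memv0 sandwichE => /andP[/A2P[h1 h2 _] /eqP h3].
      by rewrite (injN M).
    by case: (a != 0); dlia.
  move=> _ /memv_imgP[M /A2P[MA BMz Mz] ->]; apply/negP.
  rewrite -linearD /= sandwichE => Nu.
  have := kernel_point Fz (sing _ (memvD M0A MA)) _ Nu.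
  rewrite mulmxDr !mulmxDl BM0z BMz addr0 Mz addr0 => /(_ erefl) /eqP.
  by rewrite (negPf M0z).
case/memv_imgP => M /A2P[MA BMz Mz]; rewrite !sandwichE => h.
case/eqP: M0z; suff -> : M0 = M by [].
apply/eqP; rewrite -subr_eq0; apply/eqP/injN; first exact: memvB.
  by rewrite mulmxBr mulmxBl BM0z BMz subrr.
by rewrite mulmxBr mulmxBl h subrr.
Qed.

(** The case where a row combination l M is always proportional to h. Normalise
    l M = h; then M is invertible if and only if its restriction from the kernel of h
    to the kernel of l is, and these restrictions form an affine space of singular
    matrices to which the case of equality in Dieudonné's theorem applies. *)
Lemma singular_line_row m (A : {vspace 'M[K]_m.+1}) (l h : 'rV_m.+1) :
  singular_space A -> (m * m < \dim A)%N -> l != 0 -> h != 0 ->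
  (forall M, M \in A -> (l *m M <= h)%MS) ->
  [\/ m != 2%N, exists2 t : K, t != 0 & t != 1 | rank1_rows A] ->
  compressible A.
Proof.
move=> sing dimA l0 h0 lA gen.
have [lA0|] := classic (forall M, M \in A -> l *m M = 0).
  exists 1%N, m.+1, l, 1%:M; rewrite rank_rV l0 mxrank1; split=> //.
  by apply/subvP => M /lA0 lM; apply/compspaceP; rewrite lM mul0mx.
move=> nz; have [M1' nM1'] := not_all_ex_not _ _ nz.
have [M1'A /eqP lM1'] := imply_to_and _ _ nM1'.
have [M1 M1A lM1] : exists2 M1, M1 \in A & l *m M1 = h.
  have /sub_rVP[k lk] := lA _ M1'A; have k0 : k != 0.
    by apply: contraNneq lM1' => k0; rewrite lk k0 scale0r.
  by exists (k^-1 *: M1'); rewrite ?memvZ // -scalemxAr lk scalerA mulVf ?scale1r.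
have [a [Y [B Fl]]] := exists_frame l0; have [a' [Y' [B' Fh]]] := exists_frame h0.
have hB' := frame_mulT Fh; have lB := frame_mulT Fl.
have [_ _ _ BY _] := Fl; have [_ _ _ BY' _] := Fh.
have lMB M : M \in A -> l *m M *m B'^T = 0.
  by move=> /lA/sub_rVP[k ->]; rewrite -scalemxAl hB' scaler0.
have unitM M : M \in A -> l *m M = h -> Y *m M *m B'^T \notin unitmx.
  move=> MA lM; apply/negP => Nu; case/negP: (sing _ MA).
  apply: unitmx_of_ker => x Mx.
  have hx : h *m x^T = 0 by rewrite -lM -mulmxA Mx mulmx0.
  have xE := frame_decT x^T Fh; rewrite hx mulmx0 add0r in xE.
  have /(unitmx_ker Nu) : Y *m M *m B'^T *m ((Y' *m x^T)^T)^T = 0.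
    by rewrite trmxK -[_ *m B'^T *m _]mulmxA -xE -mulmxA Mx mulmx0.
  move/(congr1 trmx); rewrite trmxK trmx0 => Yx.
  by rewrite -[x]trmxK xE Yx mulmx0 trmx0.
pose A0 := (A :&: compspace l (1%:M : 'M_m.+1))%VS.
have A0P M : reflect (M \in A /\ l *m M = 0) (M \in A0).
  rewrite memv_cap; apply: (iffP andP) => -[-> h']; split=> //.
    by move/compspaceP: h'; rewrite trmx1 mulmx1.
  by apply/compspaceP; rewrite trmx1 mulmx1.
have decA M : M \in A -> exists k, exists2 M', M' \in A0 & M = k *: M1 + M'.
  move=> MA; have /sub_rVP[k lk] := lA _ MA.
  exists k, (M - k *: M1); last by rewrite addrC subrK.
  apply/A0P; rewrite memvB ?memvZ //; split=> //.
  by rewrite mulmxBr lk -scalemxAr lM1 subrr.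
have dimA0 : (\dim A <= \dim A0 + 1)%N.
  have sub : (A <= A0 + <[M1]>)%VS.
    apply/subvP => M /decA[k [M' M'A ->]]; rewrite addrC memv_add //.
    by rewrite memvZ // memv_line.
  apply: leq_trans (dimvS sub) _; have [d _] := dimv_add_leqif A0 <[M1]>%VS.
  by apply: leq_trans d _; rewrite leq_add2l dim_vline; case: (_ != 0).
have kerN : (\dim (A0 :&: compspace Y B') <= m)%N.
  have sub : (A0 :&: compspace Y B' <= compspace (1%:M : 'M_m.+1) B' :&: compspace l (1%:M : 'M_m.+1))%VS.
    apply/subvP => M; rewrite !memv_cap => /andP[/andP[MA lM] /compspaceP YM].
    rewrite lM andbT; apply/compspaceP; rewrite mul1mx.
    rewrite (frame_decT (M *m B'^T) Fl) [l *m _]mulmxA lMB // [Y *m _]mulmxA YM.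
    by rewrite !mulmx0 addr0.
  apply: leq_trans (dimvS sub) _.
  have := dim_compspace_cap l (submx1 B'); have := frame_free Fh.
  rewrite rank_rV l0 mxrank1 => ->; dlia.
have dimN : (m * m <= \dim (sandwich Y B' @: A0) + m)%N.
  have := limg_ker_dim (sandwich Y B') A0; rewrite -/(compspace Y B').
  move: kerN; rewrite /compspace; dlia.
have singN N : N \in (sandwich Y B' @: A0)%VS -> sandwich Y B' M1 + N \notin unitmx.
  move=> /memv_imgP[M /A0P[MA lM] ->]; rewrite -linearD /= sandwichE unitM ?memvD //.
  by rewrite mulmxDr lM addr0.
have [|[x x0 Nx]|[x x0 xN]] := dieudonne_eq dimN singN.
- case: gen => [m2|t|rows]; [by constructor 1|by constructor 2|constructor 3].
  move=> w' w0'; have [w wB] : exists w, w *m B'^T = w'.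
    by exists (w' *m Y'); rewrite -mulmxA -[Y']trmxK -trmx_mul BY' trmx1 mulmx1.
  have w0 : w != 0 by apply: contraNneq w0' => w0; rewrite -wB w0 mul0mx.
  have [c c0 cwA] := rows w w0.
  have lc : l *m c^T = 0.
    have := lMB _ cwA; rewrite mulmxA -mulmxA wB.
    rewrite [l *m _]mx11_scalar mul_scalar_mx => /eqP.
    by rewrite scaler_eq0 (negPf w0') orbF => /eqP ->; rewrite raddf0.
  exists (Y *m c^T)^T.
    apply: contraNneq c0 => Yc; rewrite -[c]trmxK (frame_decT c^T Fl) lc mulmx0 add0r.
    by rewrite -[Y *m _]trmxK Yc trmx0 mulmx0 trmx0.
  apply/memv_imgP; exists (c^T *m w); last by rewrite sandwichE trmxK -!mulmxA wB.
  by apply/A0P; rewrite mulmxA lc mul0mx.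
- exists m.+1, 1%N, 1%:M, (x *m B'); rewrite mxrank1 rank_rV.
  have -> : x *m B' != 0.
    apply: contraNneq x0 => h'; rewrite -[x]mulmx1 -BY' mulmxA h' mul0mx //.
  rewrite addn1; split=> //; apply/subvP => M MA; apply/compspaceP; rewrite mul1mx.
  rewrite trmx_mul (frame_decT (M *m (B'^T *m x^T)) Fl).
  have -> : l *m (M *m (B'^T *m x^T)) = 0 by rewrite !mulmxA lMB // mul0mx.
  suff -> : Y *m (M *m (B'^T *m x^T)) = 0 by rewrite !mulmx0 addr0.
  have [k [M' M'A ->]] := decA M MA.
  have := Nx 0 (mem0v _); have := Nx _ (memv_img (sandwich Y B') M'A).
  rewrite addr0 mulmxDl !sandwichE => + N1; rewrite N1 add0r => N2.
  rewrite -!mulmxA in N1 N2.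
  by rewrite mulmxDl mulmxDr -scalemxAl -scalemxAr N1 N2 scaler0 addr0.
exists (1 + 1)%N, m, (col_mx l (x *m Y)), B'; rewrite (frame_free Fh).
have -> : \rank (col_mx l (x *m Y)) = 2%N.
  apply/eqP; rewrite -/(row_free _) -kermx_eq0 -submx0; apply/rV_subP => v.
  rewrite -[v]hsubmxK => /sub_kermxP; rewrite mul_row_col => vE.
  have YB : Y *m B^T = 1%:M by rewrite -[Y]trmxK -trmx_mul BY trmx1.
  have := congr1 (mulmx^~ B^T) vE; rewrite mulmxDl -!mulmxA lB YB mulmx0 add0r mulmx1 mul0mx.
  move=> rx; have r0 : rsubmx v = 0.
    move/eqP: rx; rewrite [rsubmx v]mx11_scalar mul_scalar_mx scaler_eq0.
    by rewrite (negPf x0) orbF => /eqP ->; apply/matrixP => i j; rewrite !mxE mul0rn.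
  move: vE; rewrite r0 mul0mx addr0 => lx; suff -> : lsubmx v = 0 by rewrite row_mx0 sub0mx.
  move/eqP: lx; rewrite [lsubmx v]mx11_scalar mul_scalar_mx scaler_eq0.
  by rewrite (negPf l0) orbF => /eqP ->; apply/matrixP => i j; rewrite !mxE mul0rn.
split=> //; apply/subvP => M MA; apply/compspaceP; rewrite !mul_col_mx lMB //.
rewrite -[0 in RHS]col_mx0; congr col_mx.
have [k [M' M'A ->]] := decA M MA.
have := xN 0 (mem0v _); have := xN _ (memv_img (sandwich Y B') M'A).
rewrite addr0 mulmxDr !sandwichE => + N1; rewrite N1 add0r => N2.
rewrite mulmxDr mulmxDl -scalemxAr -scalemxAl.
by rewrite !mulmxA in N1 N2; rewrite N1 N2 scaler0 addr0.
Qed.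

End Singular.

(** * Large singular spaces with a line of rank one matrices *)

Section ColumnLine.
Variable K : fieldType.

Section AtPoint.
Variables (m : nat) (A : {vspace 'M[K]_m.+1}) (e h : 'rV[K]_m.+1).
Hypotheses (sing : singular_space A) (dimA : (m * m < \dim A)%N).
Hypotheses (rows : rank1_rows A) (ehA : e^T *m h \in A) (h0 : h != 0).
Hypothesis eA : forall w : 'rV[K]_m.+1, e^T *m w \in A -> (w <= h)%MS.
Variables (a : 'rV[K]_m.+1) (Y B : 'M[K]_(m, m.+1)).
Hypothesis Fe : frame e a Y B.

(** Throughout, the w with e^T w in A form the line spanned by h. *)
Lemma col_line_ker : (\dim (A :&: compspace B (1%:M : 'M_m.+1)) <= 1)%N.
Proof.
suff sub : (A :&: compspace B (1%:M : 'M_m.+1) <= <[e^T *m h]>)%VS.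
  by apply: leq_trans (dimvS sub) _; rewrite dim_vline; case: (_ != 0).
apply/subvP => M; rewrite memv_cap => /andP[MA /compspaceP].
rewrite trmx1 mulmx1 => /(frame_rank1 Fe) ME.
have /eA/sub_rVP[k ak] : e^T *m (a *m M) \in A by rewrite -ME.
by rewrite ME ak -scalemxAr memvZ // memv_line.
Qed.

(** Let h z <> 0. The reductions modulo e of those M in A that send z into the line
    of e form a linear space of singular matrices with the least codimension, and
    the rank one matrices of A exclude a common right kernel; hence they are all the
    matrices killed on the left by some l. *)
Lemma col_line_point (z a' : 'rV[K]_m.+1) (Y' B' : 'M[K]_(m, m.+1)) :
  frame z a' Y' B' -> h *m z^T != 0 ->
  exists l : 'rV_m, [/\ l != 0,
    forall M, M \in A -> B *m M *m z^T = 0 -> l *m (B *m M) = 0,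
    forall (c : 'rV_m) (w : 'rV_m.+1), l *m c^T = 0 -> w *m z^T = 0 ->
      exists2 M, M \in A & B *m M = c^T *m w &
    (\dim A <= m * m + 1)%N].
Proof.
move=> Fz hz; have [_ B'z _ B'Y' _] := Fz.
pose Az := (A :&: compspace B z)%VS; pose N := sandwich B Y'.
have AzP M : reflect (M \in A /\ B *m M *m z^T = 0) (M \in Az).
  by rewrite memv_cap; apply: (iffP andP) => -[-> /compspaceP].
have BME M : B *m M *m z^T = 0 -> B *m M = N M *m B'.
  move=> BMz; rewrite sandwichE -[_ *m Y'^T *m _]mulmxA.
  have [_ _ _ _ E] := Fz; move: (congr1 (mulmx (B *m M)) E).
  by rewrite mulmx1 mulmxDr [_ *m (z^T *m _)]mulmxA BMz mul0mx add0r => ->.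
have singN P : P \in (N @: Az)%VS -> 0 + P \notin unitmx.
  rewrite add0r => /memv_imgP[M /AzP[MA BMz] ->]; rewrite sandwichE; apply/negP => Nu.
  have Mz := kernel_point Fz (sing MA) BMz Nu.
  have BeT w : B *m (e^T *m w) = 0 by case: Fe => _ Be _ _ _; rewrite mulmxA Be mul0mx.
  have := @kernel_point _ _ (M + e^T *m h) B _ _ _ _ Fz.
  rewrite mulmxDr BeT addr0 mulmxDl Mz add0r => /(_ _ _ Nu) => E.
  have := E (sing (memvD MA ehA)) BMz.
  rewrite -mulmxA [h *m _]mx11_scalar mul_mx_scalar => /eqP.
  rewrite scaler_eq0 => /orP[/eqP hz0|/eqP e0].
    by case/eqP: hz; rewrite [h *m _]mx11_scalar hz0; apply/matrixP => i j; rewrite !mxE mul0rn.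
  by have := frame_neq0 Fe; rewrite -[e]trmxK e0 trmx0 eqxx.
have dimAz : (\dim A <= \dim Az + m)%N.
  by have := dim_cap_compspace B z A; rewrite (frame_free Fe) rank_rV (frame_neq0 Fz) muln1.
have kerN : (\dim (Az :&: lker N) <= 1)%N.
  apply: leq_trans col_line_ker; apply: dimvS; apply/subvP => M.
  case/memv_capP => /AzP[MA BMz]; rewrite memv_ker => /eqP NM.
  apply/memv_capP; split=> //; apply/compspaceP.
  by rewrite BME // NM !mul0mx.
have dimk := limg_ker_dim N Az.
have D := dieudonne singN.
have dimN : (m * m <= \dim (N @: Az) + m)%N by dlia.
have rowsN : rank1_rows (N @: Az)%VS.
  move=> w' w0'; pose w := w' *m B'.
  have wY : w *m Y'^T = w' by rewrite /w -mulmxA B'Y' mulmx1.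
  have wz : w *m z^T = 0 by rewrite /w -mulmxA B'z mulmx0.
  have w0 : w != 0 by apply: contraNneq w0' => w0; rewrite -wY w0 mul0mx.
  move: w wY wz w0 => w wY wz w0.
  have [c c0 cwA] := rows w0.
  exists (B *m c^T)^T.
    apply/negP => /eqP Bc; have := frame_rank1 Fe (M := c^T).
    rewrite -[B *m _]trmxK Bc trmx0 => /(_ erefl).
    rewrite [a *m _]mx11_scalar mul_mx_scalar; set s := (_ 0 0) => cE.
    have s0 : s != 0.
      by apply: contraNneq c0 => s0; rewrite -[c]trmxK cE s0 scale0r trmx0.
    have /eA/sub_rVP[k wk] : e^T *m w \in A.
      by rewrite -[_ *m _]scale1r -(mulVf s0) -scalerA scalemxAl -cE memvZ.
    case/eqP: w0; rewrite wk; move/eqP: wz; rewrite wk -scalemxAl scaler_eq0 (negPf hz) orbF.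
    by move/eqP ->; rewrite scale0r.
  apply/memv_imgP; exists (c^T *m w).
    by apply/AzP; split=> //; rewrite -!mulmxA wz !mulmx0.
  by rewrite sandwichE trmxK -!mulmxA wY.
have [|[x x0 Nx]|[l l0 lN]] := dieudonne_eq dimN singN; first by constructor 3.
  have /existsP[j xj] : [exists j, x 0 j != 0].
    apply: contraNT x0; rewrite negb_exists => /forallP h'.
    by apply/eqP/rowP => j; rewrite mxE; apply/eqP; move: (h' j); rewrite negbK.
  have [|c c0 cN] := rowsN (delta_mx 0 j).
    by apply/eqP => /matrixP/(_ 0 j)/eqP; rewrite !mxE !eqxx oner_eq0.
  have := Nx _ cN; rewrite add0r -mulmxA.
  have -> : (delta_mx 0 j : 'rV_m) *m x^T = (x 0 j)%:M.
    by rewrite -rowE -tr_col [col j x]mx11_scalar tr_scalar_mx mxE.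
  rewrite mul_mx_scalar => /eqP; rewrite scaler_eq0 (negPf xj) /= => /eqP cT.
  by case/eqP: c0; rewrite -[c]trmxK cT trmx0.
have lNM M : M \in Az -> l *m N M = 0.
  by move=> MA; have := lN _ (memv_img N MA); rewrite add0r.
exists l; split=> //; last by dlia.
  by move=> M MA BMz; rewrite BME // mulmxA lNM ?mul0mx //; apply/AzP.
have NAz : (N @: Az)%VS = compspace l (1%:M : 'M_m).
  apply/eqP; rewrite eqEdim; apply/andP; split.
    apply/subvP => _ /memv_imgP[M /lNM lM ->]; apply/compspaceP.
    by rewrite lM mul0mx.
  by have := dim_compspace l (1%:M : 'M[K]_m); rewrite rank_rV l0 mxrank1; dlia.
move=> c w lc wz; have : c^T *m w *m Y'^T \in (N @: Az)%VS.
  by rewrite NAz; apply/compspaceP; rewrite !mulmxA lc !mul0mx.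
case/memv_imgP => M /AzP[MA BMz] NM; exists M => //; rewrite BME // -NM.
have := frame_decT w^T Fz; have := congr1 trmx wz; rewrite trmx_mul trmxK trmx0 => zw.
rewrite zw mulmx0 add0r => /(congr1 trmx).
by rewrite !trmx_mul !trmxK -!mulmxA => <-.
Qed.

End AtPoint.

Lemma col_line_arith1 m d : (0 < m)%N ->
  (d + 1 * (m - 1) + m * 1 = m * m -> d <= (m - 1) * (m - 1))%N.
Proof. by case: m => // k _; rewrite subn1 /=; lia. Qed.

Lemma col_line_arith2 m dA dz dz' dcap dS d0 : (0 < m)%N ->
  (m * m < dA -> dA <= m * m + 1 -> dA <= dz + m -> dA <= dz' + m ->
   dcap <= 1 + (m - 1) * (m - 1) -> dS + dcap = dz + dz' -> dS <= d0 ->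
   dA <= d0 + 1)%N.
Proof. by case: m => // k _; rewrite subn1 /=; lia. Qed.

(** If the w with e^T w in A form the line spanned by h, then, for two vectors z and
    z' outside the kernel of h, the rows l given by the preceding lemma agree;
    counting dimensions, l B M takes its values in a line. *)
Lemma singular_col_line m (A : {vspace 'M[K]_m.+1}) (e h : 'rV[K]_m.+1) :
  (1 < m)%N -> singular_space A -> (m * m < \dim A)%N -> rank1_rows A ->
  e != 0 -> h != 0 -> e^T *m h \in A ->
  (forall w : 'rV[K]_m.+1, e^T *m w \in A -> (w <= h)%MS) ->
  compressible A.
Proof.
move=> m_gt1 sing dimA rows e0 h0 ehA eA.
have [a [Y [B Fe]]] := exists_frame e0; have [z [Yh [Bh Fh]]] := exists_frame h0.
have [hz _ _ BhYh _] := Fh; have hBh := frame_mulT Fh.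
have m_gt0 : (0 < m)%N by apply: ltnW.
pose j0 := Ordinal m_gt0.
have [v v0 hv] : exists2 v : 'rV_m.+1, v != 0 & h *m v^T = 0.
  exists (row j0 Bh).
    apply/negP => /eqP/(congr1 (mulmx^~ Yh^T)); rewrite -row_mul BhYh mul0mx.
    by move/matrixP/(_ 0 j0)/eqP; rewrite !mxE eqxx oner_eq0.
  by rewrite rowE trmx_mul mulmxA hBh mul0mx.
have hz0 : h *m z^T != 0.
  by apply/eqP => h'; move: hz; rewrite h' => /matrixP/(_ 0 0)/eqP; rewrite !mxE eq_sym oner_eq0.
pose z' := z + v; have hz' : h *m z'^T != 0 by rewrite linearD mulmxDr hv addr0.
have z0 : z != 0 by apply: contraNneq hz0 => ->; rewrite trmx0 mulmx0.
have z'0 : z' != 0 by apply: contraNneq hz' => ->; rewrite trmx0 mulmx0.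
have [az [Yz [Bz Fz]]] := exists_frame z0.
have [az' [Yz' [Bz' Fz']]] := exists_frame z'0.
have [l [l0 lP _ dA]] := col_line_point sing dimA rows ehA h0 eA Fe Fz hz0.
have [l' [_ lP' onto' _]] := col_line_point sing dimA rows ehA h0 eA Fe Fz' hz'.
have [w w0 [wz wz']] : exists2 w : 'rV_m.+1, w != 0 & w *m z^T = 0 /\ w *m z'^T = 0.
  have : kermx (col_mx z v)^T != 0.
    rewrite -mxrank_eq0 mxrank_ker mxrank_tr subn_eq0 -ltnNge.
    by apply: leq_ltn_trans (rank_leq_row _) _; rewrite ltnS.
  case/rowV0Pn => w /sub_kermxP; rewrite tr_col_mx mul_mx_row -[0 in RHS]row_mx0.
  case/eq_row_mx => wz wv w0; exists w => //; split=> //.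
  by rewrite linearD mulmxDr wz wv addr0.
have ll' (c : 'rV_m) : l' *m c^T = 0 -> l *m c^T = 0.
  move=> lc; have [M MA BM] := onto' c w lc wz'.
  have := lP M MA; rewrite BM -mulmxA wz mulmx0 => /(_ erefl).
  rewrite mulmxA [l *m _]mx11_scalar mul_scalar_mx => /eqP.
  rewrite scaler_eq0 (negPf w0) orbF => /eqP ->.
  by apply/matrixP => i j; rewrite !mxE mul0rn.
have lP2 M : M \in A -> B *m M *m z'^T = 0 -> l *m (B *m M) = 0.
  move=> MA BMz'; apply: mulmx_trV_eq0 => x.
  rewrite -mulmxA -[_ *m x^T]trmxK; apply: ll'.
  by rewrite trmxK mulmxA lP' ?mul0mx.
pose Az := (A :&: compspace B z)%VS; pose Az' := (A :&: compspace B z')%VS.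
pose L := l *m B; pose A0 := (A :&: compspace L (1%:M : 'M_m.+1))%VS.
have L0 : L != 0.
  have [_ _ _ BY _] := Fe; apply: contraNneq l0 => L0.
  by rewrite -[l]mulmx1 -BY mulmxA -/L L0 mul0mx.
have sub : (Az + Az' <= A0)%VS.
  rewrite subv_add; apply/andP; split; apply/subvP => M /memv_capP[MA /compspaceP BMz];
    apply/memv_capP; split=> //; apply/compspaceP; rewrite trmx1 mulmx1 /L -mulmxA.
    exact: lP.
  exact: lP2.
have dAz : (\dim A <= \dim Az + m)%N.
  by have := dim_cap_compspace B z A; rewrite (frame_free Fe) rank_rV z0 muln1.
have dAz' : (\dim A <= \dim Az' + m)%N.
  by have := dim_cap_compspace B z' A; rewrite (frame_free Fe) rank_rV z'0 muln1.
have dcap : (\dim (Az :&: Az') <= 1 + (m - 1) * (m - 1))%N.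
  rewrite -(limg_ker_dim (sandwich B Yz)) leq_add //.
    apply: leq_trans (col_line_ker eA Fe); apply: dimvS; apply/subvP => M.
    case/memv_capP => /memv_capP[/memv_capP[MA /compspaceP BMz] _].
    rewrite memv_ker sandwichE => /eqP NM; apply/memv_capP; split=> //; apply/compspaceP.
    have [_ _ _ _ E] := Fz; move: (congr1 (mulmx (B *m M)) E).
    rewrite mulmx1 mulmxDr [_ *m (z^T *m _)]mulmxA BMz mul0mx add0r.
    by rewrite [_ *m (Yz^T *m _)]mulmxA NM mul0mx => <-; rewrite mul0mx.
  pose y := z' *m Bz^T.
  have y0 : y != 0.
    have [_ Bzz _ _ _] := Fz; apply/negP => /eqP/(congr1 trmx).
    rewrite trmx_mul trmxK trmx0 linearD mulmxDr Bzz add0r => Bzv.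
    have := frame_dec v Fz; rewrite Bzv mulmx0 addr0.
    rewrite [az *m _]mx11_scalar mul_mx_scalar => vE; case/eqP: v0.
    move: (congr1 (mulmx h) vE); rewrite hv -scalemxAr => /esym/eqP.
    rewrite scaler_eq0 (negPf hz0) orbF => /eqP s0.
    by rewrite -[v]trmxK vE s0 scale0r trmx0.
  have subN : (sandwich B Yz @: (Az :&: Az') <=
      compspace (1%:M : 'M_m) y :&: compspace l (1%:M : 'M_m))%VS.
    apply/subvP => _ /memv_imgP[M /memv_capP[/memv_capP[MA /compspaceP BMz] /memv_capP[_ /compspaceP BMz']] ->].
    apply/memv_capP; split; apply/compspaceP; rewrite sandwichE.
      rewrite mul1mx trmx_mul trmxK; have := congr1 (mulmx (B *m M)) (frame_dec z' Fz).
      rewrite mulmxDr [_ *m (z^T *m _)]mulmxA BMz mul0mx add0r BMz'.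
      by rewrite !mulmxA => <-.
    by rewrite trmx1 mulmx1 !mulmxA -(mulmxA l) lP // mul0mx.
  apply: leq_trans (dimvS subN) _.
  have := dim_compspace_cap l (submx1 y); rewrite !rank_rV l0 y0 mxrank1.
  by rewrite /nat_of_bool; apply: col_line_arith1.
have dsum := dimv_sum_cap Az Az'; have dsub := dimvS sub.
have dimg : (\dim A0 + \dim (sandwich L (1%:M : 'M_m.+1) @: A))%N = \dim A.
  exact: limg_ker_dim.
have dA0 : (\dim A <= \dim A0 + 1)%N.
  exact: col_line_arith2 m_gt0 dimA dA dAz dAz' dcap dsum dsub.
have {}dimg : (\dim (sandwich L (1%:M : 'M_m.+1) @: A) <= 1)%N.
  by rewrite -(leq_add2l (\dim A0)) dimg.
have [r r0 rP] : exists2 r : 'rV_m.+1, r != 0 &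
    (sandwich L (1%:M : 'M_m.+1) @: A <= <[r]>)%VS.
  move: (_ @: A)%VS dimg => W dimW; have [W0|W0] := eqVneq W 0%VS.
    by exists h => //; rewrite W0 sub0v.
  pose r : 'rV[K]_m.+1 := vpick W; have r0 : r != 0 by rewrite vpick0.
  exists r => //; have rW : (<[r]> <= W)%VS by rewrite -memvE memv_pick.
  suff -> : W = <[r]>%VS by [].
  by apply/esym/eqP; rewrite eqEdim rW dim_vline r0.
apply: (singular_line_row sing dimA L0 r0); last by constructor 3.
move=> M MA; have := subvP rP _ (memv_img _ MA); rewrite sandwichE trmx1 mulmx1.
by case/vlineP => k ->; rewrite scalemx_sub.
Qed.

End ColumnLine.

(** * Large singular spaces are compressible *)

Section Compression.
Variable K : fieldType.

Lemma compressible_trv n (A : {vspace 'M[K]_n}) :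
  compressible (trv A) -> compressible A.
Proof.
case=> p [q [U [X [rUX sub]]]]; exists q, p, X, U; split; first by rewrite addnC.
apply/subvP => M MA; apply/compspaceP/trmx_inj.
have /(subvP sub)/compspaceP : M^T \in trv A by rewrite mem_trv trmxK.
by rewrite !trmx_mul !trmxK trmx0 mulmxA.
Qed.

Lemma singular_trv n (A : {vspace 'M[K]_n}) :
  singular_space A -> singular_space (trv A).
Proof. by move=> sing M; rewrite mem_trv => /sing; rewrite unitmx_tr. Qed.

Lemma compressible_row n (A : {vspace 'M[K]_n}) (l : 'rV_n) : l != 0 ->
  (forall M, M \in A -> l *m M = 0) -> compressible A.
Proof.
move=> l0 lA; exists 1%N, n, l, 1%:M; rewrite rank_rV l0 mxrank1; split=> //.
by apply/subvP => M /lA lM; apply/compspaceP; rewrite lM mul0mx.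
Qed.

Lemma compressible_col n (A : {vspace 'M[K]_n}) (x : 'rV_n) : x != 0 ->
  (forall M, M \in A -> M *m x^T = 0) -> compressible A.
Proof.
move=> x0 Ax; apply: compressible_trv; apply: (compressible_row x0) => M.
by rewrite mem_trv => /Ax Mx; apply: trmx_inj; rewrite trmx_mul Mx trmx0.
Qed.

Lemma compressible_of_codim_le_n n (A : {vspace 'M[K]_n}) : singular_space A ->
  (n * n <= \dim A + n)%N ->
  [\/ n != 2%N, exists2 t : K, t != 0 & t != 1 | rank1_rows A] ->
  compressible A.
Proof.
move=> sing dimA gen.
have sing0 M : M \in A -> 0 + M \notin unitmx by rewrite add0r; apply: sing.
have [[x x0 Ax]|[l l0 lA]] := dieudonne_eq dimA sing0 gen.
  by apply: (compressible_col x0) => M /Ax; rewrite add0r.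
by apply: (compressible_row l0) => M /lA; rewrite add0r.
Qed.

(** For each nonzero e, the w with e^T w in A span a space of dimension at least 2:
    they are not contained in any line. *)
Definition fat_cols n (A : {vspace 'M[K]_n}) := forall e h : 'rV[K]_n,
  e != 0 -> exists2 w : 'rV[K]_n, ~~ (w <= h)%MS & e^T *m w \in A.
(** For each nonzero w, the e with e^T w in A are not contained in any line. *)
Definition fat_rows n (A : {vspace 'M[K]_n}) := forall w h : 'rV[K]_n,
  w != 0 -> exists2 e : 'rV[K]_n, ~~ (e <= h)%MS & e^T *m w \in A.

Lemma fat_rows_trv n (A : {vspace 'M[K]_n}) : fat_rows A <-> fat_cols (trv A).
Proof.
by split=> fA e h e0; have [w wh ewA] := fA e h e0; exists w => //;
  move: ewA; rewrite mem_trv trmx_mul trmxK.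
Qed.

Lemma fat_cols_trv n (A : {vspace 'M[K]_n}) : fat_cols A <-> fat_rows (trv A).
Proof.
by split=> fA e h e0; have [w wh ewA] := fA e h e0; exists w => //;
  move: ewA; rewrite mem_trv trmx_mul trmxK.
Qed.

(** Completion of independent rows into a basis, with the dual basis. *)
Lemma exists_complement p k n (X : 'M[K]_(p, n)) : (p + k)%N = n -> \rank X = p ->
  exists (F : 'M_(k, n)) (P : 'M_(n, p)) (Q : 'M_(n, k)),
  [/\ X *m P = 1%:M, X *m Q = 0, F *m P = 0, F *m Q = 1%:M
    & P *m X + Q *m F = 1%:M].
Proof.
move=> pkn; subst n => rX.
pose R : 'M_(p + k, p + k) := row_ebase X; pose F := dsubmx R.
have XE : X = col_ebase X *m usubmx R.
  have pR : (pid_mx p : 'M_(p, p + k)) *m R = usubmx R.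
    by rewrite pid_mx_row -[R]vsubmxK mul_row_col mul1mx mul0mx addr0 vsubmxK.
  by rewrite -{1}(mulmx_ebase X) rX -pR mulmxA.
pose T := col_mx X F.
have Tu : T \in unitmx.
  have -> : T = block_mx (col_ebase X) 0 0 1%:M *m R.
    by rewrite -[R]vsubmxK mul_block_col !mul0mx addr0 add0r mul1mx -XE.
  rewrite unitmx_mul row_ebase_unit andbT unitmxE det_ublock det1 mulr1 -unitmxE.
  exact: col_ebase_unit.
exists F, (lsubmx (invmx T)), (rsubmx (invmx T)).
have := mulmxV Tu; rewrite -[X in _ *m X]hsubmxK mul_col_row scalar_mx_block.
case/eq_block_mx => -> -> -> ->; split=> //.
by rewrite -mul_row_col hsubmxK -/T mulVmx // -scalar_mx_block.
Qed.

Lemma sub_span2 n (Q : 'M[K]_(2, n)) (c1 c2 : 'rV[K]_n) :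
  (c1 <= Q)%MS -> (c2 <= Q)%MS -> c1 != 0 -> ~~ (c2 <= c1)%MS ->
  (Q <= c1 + c2)%MS.
Proof.
move=> c1Q c2Q c10 c21.
have sub : (c1 + c2 <= Q)%MS by rewrite addsmx_sub c1Q.
have r1 : \rank c1 = 1%N by rewrite rank_rV c10.
rewrite -(mxrank_leqif_sup sub) eqn_leq mxrankS //=.
apply: leq_trans (rank_leq_row Q) _.
have : (\rank c1 < \rank (c1 + c2)%MS)%N; last by rewrite r1.
by rewrite ltn_neqAle mxrankS ?addsmxSl // andbT (mxrank_leqif_sup (addsmxSl c1 c2))
  addsmx_sub submx_refl.
Qed.

Lemma in_span2 n (c c1 c2 w : 'rV[K]_n) (A : {vspace 'M[K]_n}) :
  (c <= c1 + c2)%MS -> c1^T *m w \in A -> c2^T *m w \in A -> c^T *m w \in A.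
Proof.
case/sub_addsmxP => -[/= a b] -> h1 h2.
rewrite [a]mx11_scalar [b]mx11_scalar !mul_scalar_mx.
by rewrite linearD !linearZ /= mulmxDl -!scalemxAl memvD ?memvZ.
Qed.

Lemma in_rank1_sum p n (A : {vspace 'M[K]_n}) (P : 'M[K]_(n, p)) (D : 'M[K]_(p, n)) :
  (forall i, col i P *m row i D \in A) -> P *m D \in A.
Proof.
move=> h; suff -> : P *m D = \sum_i col i P *m row i D by apply: memv_suml.
apply/matrixP => x y; rewrite !mxE summxE; apply: eq_bigr => i _.
by rewrite !mxE big_ord1 !mxE.
Qed.

Lemma fat_arith k n dG dk dC dA : (k + 2 = n -> dG + k <= k * k -> dk <= dC ->
  dC + k * n = n * n -> dk + dG = dA -> n * n + 2 <= dA + 2 * n -> k <= 2)%N.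
Proof. by move=> <-; lia. Qed.

(** A singular space cannot be fat in both directions and be contained in a
    compression space with rank X = 2 and rank U = n - 2. The e^T w in A with
    w X^T <> 0 satisfy U e^T = 0, a condition that defines a plane; so A contains all
    the matrices with values in this plane, and only the block U M F^T matters, for F
    a complement of X. *)
Lemma fat_corank2_false n k (A : {vspace 'M[K]_n})
    (U : 'M[K]_(k, n)) (X : 'M[K]_(2, n)) :
  (k + 2)%N = n -> (1 < k)%N -> \rank U = k -> \rank X = 2%N ->
  (n * n + 2 <= \dim A + 2 * n)%N -> singular_space A ->
  (forall M, M \in A -> U *m M *m X^T = 0) ->
  fat_cols A -> fat_rows A -> False.
Proof.
move=> kn k_gt1 rU rX dimA sing AUX fcols frows.
have [G [P1 [P2 [UP1 UP2 GP1 GP2 Ures]]]] := exists_complement kn rU.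
have kn' : (2 + k)%N = n by rewrite addnC.
have [F [Q1 [Q2 [XQ1 XQ2 FQ1 FQ2 Xres]]]] := exists_complement kn' rX.
have kerU (c : 'rV_n) : U *m c^T = 0 -> (c <= P2^T)%MS.
  move=> Uc; rewrite -[c]trmxK -[c^T]mul1mx -Ures mulmxDl -mulmxA Uc mulmx0 add0r.
  by rewrite -mulmxA trmx_mul submxMl.
have kerX (w : 'rV_n) : w *m X^T = 0 -> (w <= Q2^T)%MS.
  move=> wX; have Xw : X *m w^T = 0 by rewrite -[X]trmxK -trmx_mul wX trmx0.
  rewrite -[w]trmxK -[w^T]mul1mx -Xres mulmxDl -mulmxA Xw mulmx0 add0r.
  by rewrite -mulmxA trmx_mul submxMl.
have Urow (c w : 'rV_n) : c^T *m w \in A -> w *m X^T != 0 -> U *m c^T = 0.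
  move/AUX; rewrite mulmxA -mulmxA => h /matrix0Pn[i [j]]; rewrite ord1 => wX.
  have := congr1 (col j) h; rewrite col0 colE -mulmxA -colE.
  rewrite [col j _]mx11_scalar mul_mx_scalar mxE => /eqP.
  by rewrite scaler_eq0 (negPf wX) => /eqP.
have kerU_in (c w : 'rV_n) : U *m c^T = 0 -> w *m X^T != 0 -> c^T *m w \in A.
  move=> Uc wX; have w0 : w != 0 by apply: contraNneq wX => ->; rewrite mul0mx.
  have [c1 c1n c1A] := frows w 0 w0.
  have {}c1n : c1 != 0 by apply: contraNneq c1n => ->; apply: sub0mx.
  have [c2 c2n c2A] := frows w c1 w0.
  apply: (in_span2 _ c1A c2A); apply: submx_trans (kerU c Uc) _.
  by apply: sub_span2 => //; apply: kerU; apply: Urow wX.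
have kerU_all (c w : 'rV_n) : U *m c^T = 0 -> c^T *m w \in A.
  move=> Uc; have [wX|] := eqVneq (w *m X^T) 0; last exact: kerU_in.
  pose w' := row 0 Q1^T.
  have wX' : w' *m X^T != 0.
    rewrite -row_mul -trmx_mul XQ1 trmx1; apply/eqP => /matrixP/(_ 0 0)/eqP.
    by rewrite !mxE eqxx oner_eq0.
  have -> : w = (w + w') - w' by rewrite addrK.
  rewrite mulmxBr memvB ?kerU_in // mulmxDl wX add0r //.
have Gsing M : M \in A -> U *m M *m F^T \notin unitmx.
  move=> MA; apply/negP => Nu.
  (* Adjust M so that it maps the span of X onto the kernel of U. *)
  pose M' := M + (P2 - M *m X^T) *m Q1^T.
  have M'A : M' \in A.
    apply: memvD => //; apply: in_rank1_sum => i.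
    rewrite -[col i _]trmxK; apply: kerU_all; rewrite trmxK colE mulmxA.
    by rewrite mulmxBr UP2 mulmxA AUX // subrr mul0mx.
  case/negP: (sing _ M'A); apply: unitmx_of_ker => x M'x.
  have UM' : U *m M' = U *m M.
    by rewrite mulmxDr mulmxA mulmxBr UP2 mulmxA AUX // subrr mul0mx addr0.
  have M'X : M' *m X^T = P2.
    by rewrite mulmxDl -mulmxA -trmx_mul XQ1 trmx1 mulmx1 addrC subrK.
  have xE : x^T = X^T *m (Q1^T *m x^T) + F^T *m (Q2^T *m x^T).
    have := congr1 trmx Xres; rewrite linearD /= !trmx_mul trmx1 => E.
    by rewrite !mulmxA -mulmxDl E mul1mx.
  have Q2x : Q2^T *m x^T = 0.
    have /(unitmx_ker Nu) : U *m M *m F^T *m ((Q2^T *m x^T)^T)^T = 0.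
      have : U *m M *m x^T = 0 by rewrite -UM' -mulmxA M'x mulmx0.
      by rewrite {1}xE mulmxDr [_ *m (X^T *m _)]mulmxA AUX // mul0mx add0r trmxK mulmxA.
    by move/(congr1 trmx); rewrite trmxK trmx0.
  rewrite Q2x mulmx0 addr0 in xE.
  have Q1x : Q1^T *m x^T = 0.
    have : P2 *m (Q1^T *m x^T) = 0 by rewrite -M'X -mulmxA -xE.
    by move/(congr1 (mulmx G)); rewrite mulmxA GP2 mul1mx mulmx0.
  by rewrite -[x]trmxK xE Q1x mulmx0 trmx0.
(* The blocks U M F^T have codimension at most 2, so k <= 2 by Dieudonné's theorem;
   for k = 2 all the blocks occur, as A is fat. *)
have Ugt2 : (k <= 2)%N.
  have := @dieudonne K k 0 (sandwich U F @: A).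
  have -> : (forall M, M \in (sandwich U F @: A)%VS -> 0 + M \notin unitmx) <-> True.
    by split=> // _ _ /memv_imgP[M MA ->]; rewrite add0r sandwichE Gsing.
  move=> /(_ I) dG.
  have sub : (A :&: lker (sandwich U F) <= compspace U (1%:M : 'M_n))%VS.
    apply/subvP => M; rewrite memv_cap memv_ker sandwichE => /andP[MA /eqP UMF].
    apply/compspaceP; rewrite -Xres linearD /= mulmxDr !trmx_mul !mulmxA AUX // UMF.
    by rewrite !mul0mx addr0.
  have dk := dimvS sub; have dc := dim_compspace U (1%:M : 'M[K]_n).
  rewrite rU mxrank1 in dc; have di := limg_ker_dim (sandwich U F) A.
  exact: fat_arith kn dG dk dc di dimA.
have k2 : k = 2%N by apply/eqP; rewrite eqn_leq Ugt2.
subst k; have Gall (e w : 'rV_n) : U *m e^T != 0 -> w *m X^T = 0 -> e^T *m w \in A.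
  move=> Ue wX; have e0 : e != 0 by apply: contraNneq Ue => ->; rewrite trmx0 mulmx0.
  have Xr w' : e^T *m w' \in A -> w' *m X^T = 0.
    by move=> h; apply/eqP; apply: contraNT Ue => /(Urow _ _ h) ->.
  have [w1 w1n w1A] := fcols e 0 e0.
  have {}w1n : w1 != 0 by apply: contraNneq w1n => ->; apply: sub0mx.
  have [w2 w2n w2A] := fcols e w1 e0.
  have := @in_span2 n w w1 w2 e (trv A); rewrite !mem_trv !trmx_mul !trmxK; apply => //.
  apply: submx_trans (kerX w wX) _.
  by apply: sub_span2 => //; apply/kerX/Xr.
have : P1 *m Q2^T \in A.
  apply: in_rank1_sum => i; rewrite -[col i _]trmxK; apply: Gall.
    rewrite trmxK colE mulmxA UP1 mul1mx; apply/eqP => /matrixP/(_ i 0)/eqP.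
    by rewrite !mxE !eqxx oner_eq0.
  by rewrite -row_mul -trmx_mul XQ2 trmx0 row0.
move/Gsing; rewrite mulmxA UP1 mul1mx -trmx_mul FQ2 trmx1 unitmx1.
by [].
Qed.

End Compression.

Section AtkinsonLloyd.
Variable K : fieldType.

Lemma rank_mul_free m n p (U : 'M[K]_(p, m)) (B : 'M[K]_(m, n)) :
  \rank B = m -> \rank (U *m B) = \rank U.
Proof. by move=> rB; rewrite mxrankMfree //; apply/eqP. Qed.

Lemma fat_corank_arith k r m dA dA' dc : (k + r = m.+1 -> m * m < dA ->
  dc < 2 * m -> dc + dA' = dA -> dA' + k * r <= m * m ->
  k <= 2 \/ r <= 2)%N.
Proof.
move=> kr h1 h2 h3 h4; have [k2|k3] := leqP k 2; first by left.
right; rewrite leqNgt; apply/negP => r3.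
have h5 : (0 < (k - 2) * (r - 2))%N by rewrite muln_gt0 !subn_gt0 k3.
have [k' kE] : exists k', k = (k' + 2)%N by exists (k - 2)%N; lia.
have [r' rE] : exists r', r = (r' + 2)%N by exists (r - 2)%N; lia.
have mE : m = (k' + r' + 3)%N by lia.
by subst k r m; move: h5; rewrite !addnK; nia.
Qed.

Lemma singular_corank1 m (A : {vspace 'M[K]_m.+1}) (l : 'rV_m.+1)
    (X : 'M[K]_(m, m.+1)) :
  singular_space A -> (m * m < \dim A)%N -> l != 0 -> \rank X = m ->
  (forall M, M \in A -> l *m M *m X^T = 0) -> rank1_rows A -> compressible A.
Proof.
move=> sing dimA l0 rX lAX rows.
have [F [P [Q [XP XQ FP FQ E]]]] := exists_complement (addn1 m) rX.
apply: (@singular_line_row K m A l Q^T) => //; last by constructor 3.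
  apply/negP => /eqP/(congr1 trmx); rewrite trmxK trmx0 => Q0.
  by move: FQ => /matrixP/(_ 0 0)/eqP; rewrite Q0 mulmx0 !mxE eqxx eq_sym oner_eq0.
move=> M MA; have XM : X *m (l *m M)^T = 0.
  by apply: trmx_inj; rewrite trmx_mul trmxK lAX // trmx0.
rewrite -[l *m M]trmxK -[(l *m M)^T]mul1mx -E mulmxDl -mulmxA XM mulmx0 add0r.
by rewrite -mulmxA trmx_mul submxMl.
Qed.

Lemma not_fat_cols m (A : {vspace 'M[K]_m.+1}) :
  (1 < m)%N -> singular_space A -> (m * m < \dim A)%N ->
  rank1_cols A -> rank1_rows A -> ~ fat_cols A -> compressible A.
Proof.
move=> m_gt1 sing dimA cols rows nfat.
have [e ne] := not_all_ex_not _ _ nfat; have [h nh] := not_all_ex_not _ _ ne.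
have [e0 nw] := imply_to_and _ _ nh.
have eA (w : 'rV_m.+1) : e^T *m w \in A -> (w <= h)%MS.
  by move=> ewA; apply: contra_notT nw => wh; exists w.
have [w w0 ewA] := cols e e0.
apply: (singular_col_line m_gt1 sing dimA rows e0 w0 ewA) => w' /eA w'h.
have /sub_rVP[k wk] := eA _ ewA; have k0 : k != 0.
  by apply: contraNneq w0 => k0; rewrite wk k0 scale0r.
by apply: submx_trans w'h _; rewrite -[h]scale1r -(mulVf k0) -scalerA -wk scalemx_sub.
Qed.

(** The induction: unless A has codimension at most n, or is not fat, or has large
    crosses, the reduction of A along a cross that is not large is a singular space of
    matrices of size n - 1 to which the induction hypothesis applies. The resulting
    compression space (U1, X1) of A has rank U1 + rank X1 = n only, but one of its two
    ranks is at most 2. *)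
Theorem singular_rank1_compressible m (A : {vspace 'M[K]_m.+1}) :
  singular_space A -> (m * m < \dim A)%N ->
  rank1_cols A -> rank1_rows A -> compressible A.
Proof.
elim: m A => [|m IH] A sing dimA cols rows.
  by apply: compressible_of_codim_le_n => //; [dlia|constructor 1].
have [dimA'|dimA'] := leqP (m.+2 * m.+2) (\dim A + m.+2).
  by apply: compressible_of_codim_le_n => //; constructor 3.
have [m0|m_gt0] := posnP m; first by subst m; dlia.
have [fcols|] := classic (fat_cols A); last exact: not_fat_cols.
have [frows|nf] := classic (fat_rows A); last first.
  apply: compressible_trv; apply: not_fat_cols; rewrite ?dim_trv //.
  - exact: singular_trv.
  - exact/rank1_rows_trv.
  - exact/rank1_cols_trv.
  - by move/fat_rows_trv.
have [large|] := classic (large_crosses A).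
  by have := large_crosses_nearly_full large cols rows; dlia.
move=> nlarge.
have [e [a [Y [B [w [a' [Y' [B' [Fe [Fw [ewA dcap]]]]]]]]]]] :
    exists e a Y B w a' Y' B', frame e a Y B /\ frame w a' Y' B' /\
      e^T *m w \in A /\ (\dim (A :&: compspace B B') < 2 * m.+1)%N.
  apply: NNPP => h; apply: nlarge => e a Y B w a' Y' B' Fe Fw ewA.
  rewrite leqNgt; apply/negP => lt; apply: h.
  by exists e, a, Y, B, w, a', Y', B'.
pose f := sandwich B B'; pose A' := (f @: A)%VS.
have dimf : (\dim (A :&: compspace B B') + \dim A')%N = \dim A by apply: limg_ker_dim.
have sing' : singular_space A'.
  move=> _ /memv_imgP[M MA ->]; rewrite sandwichE.
  by apply: (cross_nonunit Fe Fw (sing _ MA)); rewrite sing // memvD.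
have [_ Be _ BY _] := Fe; have [_ Bw _ BY' _] := Fw.
have liftE (c : 'rV_m.+1) : (c *m Y)^T = Y^T *m c^T by rewrite trmx_mul.
have rB : \rank B = m.+1 := frame_free Fe.
have rB' : \rank B' = m.+1 := frame_free Fw.
have cols' : rank1_cols A'.
  move=> c c0; have e20 : c *m Y != 0.
    apply: contraNneq c0 => h; have := congr1 (mulmx B) (congr1 trmx h).
    rewrite trmx_mul mulmxA BY mul1mx trmx0 mulmx0 => ct.
    by rewrite -[c]trmxK ct trmx0.
  have [w2 w2w w2A] := fcols _ w e20.
  exists (w2 *m B'^T).
    apply: contra w2w => /eqP/(congr1 trmx); rewrite trmx_mul trmxK trmx0 => Bw2.
    have := frame_rank1 Fw Bw2; rewrite [a' *m _]mx11_scalar mul_mx_scalar.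
    by move/(congr1 trmx); rewrite linearZ /= !trmxK => ->; rewrite scalemx_sub.
  apply/memv_imgP; exists ((c *m Y)^T *m w2) => //.
  by rewrite sandwichE trmx_mul !mulmxA BY mul1mx.
have rows' : rank1_rows A'.
  move=> c c0; have e20 : c *m Y' != 0.
    apply: contraNneq c0 => h; have := congr1 (mulmx B') (congr1 trmx h).
    rewrite trmx_mul mulmxA BY' mul1mx trmx0 mulmx0 => ct.
    by rewrite -[c]trmxK ct trmx0.
  have [e2 e2e e2A] := frows _ e e20.
  exists (e2 *m B^T).
    apply: contra e2e => /eqP/(congr1 trmx); rewrite trmx_mul trmxK trmx0 => Be2.
    have := frame_rank1 Fe Be2; rewrite [a *m _]mx11_scalar mul_mx_scalar.
    by move/(congr1 trmx); rewrite linearZ /= !trmxK => ->; rewrite scalemx_sub.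
  apply/memv_imgP; exists (e2^T *m (c *m Y')) => //.
  have YB : Y' *m B'^T = 1%:M by rewrite -[Y']trmxK -trmx_mul BY' trmx1.
  by rewrite sandwichE trmx_mul trmxK -!mulmxA YB mulmx1.
have dimA2 : (m * m < \dim A')%N by move: dimA dcap dimf; clear; dlia.
have [p [q [U [X [rUX sub]]]]] := IH A' sing' dimA2 cols' rows'.
have [k [Cu [Ru [Cu' [Ru' [rU UE CuK RuK]]]]]] := rank_factorization U.
have [r [Cx [Rx [Cx' [Rx' [rX XE CxK RxK]]]]]] := rank_factorization X.
rewrite rU rX in rUX.
pose U1 := Ru *m B; pose X1 := Rx *m B'.
have rU1 : \rank U1 = k.
  by rewrite rank_mul_free //; apply/eqP/row_freeP; exists Ru'.
have rX1 : \rank X1 = r.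
  by rewrite rank_mul_free //; apply/eqP/row_freeP; exists Rx'.
have AUX M : M \in A -> U1 *m M *m X1^T = 0.
  move=> MA; have /(subvP sub)/compspaceP := memv_img f MA.
  rewrite sandwichE UE XE !trmx_mul => h.
  have := congr1 (fun N => Cu' *m N *m Cx'^T) h; rewrite /= mulmx0 mul0mx.
  have CxK' : Cx^T *m Cx'^T = 1%:M by rewrite -trmx_mul CxK trmx1.
  rewrite !mulmxA CuK mul1mx -[_ *m Cx^T *m _]mulmxA CxK' mulmx1 => h'.
  by [].
clearbody U1 X1; clear Cu' Cx' Ru' Rx' CuK RuK CxK RxK UE XE Cu Ru Cx Rx.
have kr2 : (k <= 2)%N \/ (r <= 2)%N.
  have := dimvS sub; have := dim_compspace U X; rewrite rU rX => h1 h2.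
  have h3 : (\dim A' + k * r <= m.+1 * m.+1)%N by rewrite -h1 leq_add2r.
  exact: fat_corank_arith rUX dimA dcap dimf h3.
have kle : (k <= m.+1)%N by rewrite -rU rank_leq_col.
have rle : (r <= m.+1)%N by rewrite -rX rank_leq_col.
clear rU rX.
have dimA3 : (m.+2 * m.+2 + 2 <= \dim A + 2 * m.+2)%N by move: dimA; clear; dlia.
have singT := singular_trv sing.
have AUXT M : M \in trv A -> X1 *m M *m U1^T = 0.
  rewrite mem_trv => /AUX h; apply: trmx_inj.
  by rewrite !trmx_mul trmxK trmx0 mulmxA.
have [k1|k_neq1] := eqVneq k 1%N.
  subst k; have rE : r = m.+1 by lia.
  subst r; apply: (@singular_corank1 _ A U1 X1) => //.
  by move: rU1; rewrite rank_rV; case: (_ != 0).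
have [r1|r_neq1] := eqVneq r 1%N.
  subst r; have kE : k = m.+1 by lia.
  subst k; apply: compressible_trv.
  apply: (@singular_corank1 _ (trv A) X1 U1) => //; rewrite ?dim_trv //.
    by move: rX1; rewrite rank_rV; case: (_ != 0).
  exact/rank1_cols_trv.
case: kr2 => [k_le2|r_le2].
  have k2 : k = 2%N by lia.
  subst k; case: (@fat_corank2_false K m.+2 r (trv A) X1 U1) => //; rewrite ?dim_trv //; try lia.
    exact/fat_rows_trv.
  exact/fat_cols_trv.
have r2 : r = 2%N by lia.
by subst r; case: (@fat_corank2_false K m.+2 k A U1 X1) => //; lia.
Qed.

(** Atkinson and Lloyd: a space of singular matrices with codimension at most
    n + c, where c <= n - 2, is compressible. The exception, for n = 3 over the field
    with two elements, comes from the matrices [s, 0, 0; x, t, 0; y, z, s + t], whose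
    space has dimension 5, so that c = 1. *)
Theorem atkinson_lloyd n c (A : {vspace 'M[K]_n}) :
  singular_space A -> (c + 2 <= n)%N -> (n * n <= \dim A + n + c)%N ->
  [\/ n != 3%N, c != 1%N | exists2 t : K, t != 0 & t != 1] ->
  compressible A.
Proof.
case: n A => [|m] A sing; first by rewrite addn2.
move=> cm dimA gen.
have [nt|gen'] := classic (m = 2%N /\ ~ exists2 t : K, t != 0 & t != 1).
  apply: compressible_of_codim_le_n => //; last first.
    by constructor 1; rewrite (proj1 nt).
  have [m2 nt'] := nt; subst m.
  have c1 : c != 1%N by case: gen => // t; case: nt'.
  by dlia.
have {}gen : m != 2%N \/ exists2 t : K, t != 0 & t != 1.
  case: eqVneq => [m2|]; [right|by left].
  by apply: NNPP => nt; apply: gen'.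
have dimA' : (m * m < \dim A)%N by dlia.
have [cols|ncols] := classic (rank1_cols A); last first.
  have [e ne] := not_all_ex_not _ _ ncols; have [e0 eA] := imply_to_and _ _ ne.
  have [|l l0 lA] := singular_missing_col sing dimA' gen e0.
    by move=> w ewA; apply/eqP; apply: contra_notT eA => w0; exists w.
  exact: compressible_row lA.
have [rows|nrows] := classic (rank1_rows A); last first.
  have [w nw] := not_all_ex_not _ _ nrows; have [w0 wA] := imply_to_and _ _ nw.
  apply: compressible_trv.
  have [||l l0 lA] := singular_missing_col (singular_trv sing) _ gen w0.
  - by rewrite dim_trv.
  - move=> e; rewrite mem_trv trmx_mul trmxK => ewA; apply/eqP.
    by apply: contra_notT wA => e0; exists e.
  exact: compressible_row lA.
exact: singular_rank1_compressible.
Qed.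

End AtkinsonLloyd.

(** * Weak preservers are strong preservers *)

Section Dixon.
Variable K : fieldType.

(** The span of an arbitrary set of vectors. *)
Lemma exists_span N (P : 'rV[K]_N -> Prop) :
  exists X : 'M[K]_N, (forall v, P v -> (v <= X)%MS) /\
    forall Z : 'M_N, (forall v, P v -> (v <= Z)%MS) -> (X <= Z)%MS.
Proof.
have : forall k (X : 'M[K]_N), (\rank X <= k)%N -> (forall v, P v -> (v <= X)%MS) ->
    exists X : 'M[K]_N, (forall v, P v -> (v <= X)%MS) /\
    forall Z : 'M_N, (forall v, P v -> (v <= Z)%MS) -> (X <= Z)%MS.
  elim=> [|k IH] X rX PX.
    exists X; split=> // Z _; move: rX; rewrite leqn0 mxrank_eq0 => /eqP ->.
    exact: sub0mx.
  case: (classic (exists2 Z : 'M_N, forall v, P v -> (v <= Z)%MS & ~~ (X <= Z)%MS)).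
    case=> Z PZ XZ; apply: (IH (X :&: Z)%MS); last by move=> v Pv; rewrite sub_capmx PX ?PZ.
    have : (\rank (X :&: Z)%MS < \rank X)%N; last by move=> h; rewrite -ltnS (leq_trans h).
    rewrite ltn_neqAle mxrankS ?capmxSl // andbT (mxrank_leqif_sup (capmxSl X Z)).
    by apply: contra XZ => h; apply: submx_trans h (capmxSr X Z).
  move=> nZ; exists X; split=> // Z PZ; apply/negPn/negP => XZ.
  by apply: nZ; exists Z.
by move=> /(_ N 1%:M); apply=> [|v _]; rewrite ?rank_leq_row ?submx1.
Qed.

Variable n : nat.
Local Notation I := {ffun 'I_n -> 'I_n * 'I_n}.

(** The coordinates of the n-th tensor power of the space of matrices are indexed by
    the n-tuples of positions in a matrix. *)
Definition multi_index (s : 'I_#|{: I}|) : I := enum_val s.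

(** The n-th tensor power of M, whose entries are the products of n entries of M. *)
Definition veronese (M : 'M[K]_n) : 'rV[K]_#|{: I}| :=
  \row_s \prod_k M (multi_index s k).1 (multi_index s k).2.

(** The action on the n-th tensor power of a linear map L, cf. [veroneseM]. *)
Definition veronese_mx (L : 'End('M[K]_n)) : 'M[K]_#|{: I}| :=
  \matrix_(r, s) \prod_k L (delta_mx (multi_index r k).1 (multi_index r k).2)
                           (multi_index s k).1 (multi_index s k).2.

Lemma veroneseM (L : 'End('M[K]_n)) M : veronese (L M) = veronese M *m veronese_mx L.
Proof.
apply/rowP => s; rewrite !mxE; set t := multi_index s.
have LE i j : L M i j = \sum_(p : 'I_n * 'I_n) M p.1 p.2 * L (delta_mx p.1 p.2) i j.
  rewrite {1}[M]matrix_sum_delta pair_bigA linear_sum summxE.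
  by apply: eq_bigr => p _; rewrite linearZ !mxE.
under eq_bigr => k _ do rewrite LE.
rewrite bigA_distr_bigA (reindex_onto multi_index enum_rank) /=; last first.
  by move=> r _; rewrite /multi_index enum_rankK.
rewrite [LHS](eq_bigl xpredT) => [|r]; last by rewrite /multi_index enum_valK eqxx.
apply: eq_bigr => r _; rewrite !mxE -big_split /=.
by apply: eq_bigr.
Qed.

(** The determinant as a linear form on the n-th tensor power. *)
Definition veronese_det : 'cV[K]_#|{: I}| :=
  \col_r \sum_(s : 'S_n) (-1) ^+ s *+ (multi_index r == [ffun k => (k, s k)]).

Lemma veronese_detE M : veronese M *m veronese_det = (\det M)%:M.
Proof.
apply/matrixP => i j; rewrite !ord1 !mxE eqxx mulr1n.
transitivity (\sum_(r < #|{: I}|) \sum_(s : 'S_n)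
   ((-1) ^+ s * \prod_k M k (s k)) *+ (multi_index r == [ffun k => (k, s k)])).
  apply: eq_bigr => r _; rewrite !mxE mulr_sumr; apply: eq_bigr => s _.
  case: eqP => [->|_]; last by rewrite !mulr0n mulr0.
  by rewrite !mulr1n mulrC; congr (_ * _); apply: eq_bigr => k _; rewrite ffunE.
rewrite exchange_big /=; apply: eq_bigr => s _.
rewrite (bigD1 (enum_rank [ffun k => (k, s k)])) //= /multi_index enum_rankK eqxx mulr1n.
rewrite [X in _ + X]big1 ?addr0 // => r rn; case: eqP => // h.
by case/eqP: rn; rewrite -h enum_valK.
Qed.

(** The span X of the tensor powers of the singular matrices of V is stable under the
    action of the inverse G of F; as it has finite dimension, it is also stable under
    the action of F. *)
Lemma preserves_singular (V : {vspace 'M[K]_n}) (F G : 'End('M[K]_n)) :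
  (forall M, M \in V -> G M \in V) -> (forall M, M \in V -> F (G M) = M) ->
  (forall M, M \in V -> M \in unitmx -> F M \in unitmx) ->
  forall M, M \in V -> M \notin unitmx -> F M \notin unitmx.
Proof.
move=> GV FG Fu.
pose P v := exists M, [/\ M \in V, M \notin unitmx & v = veronese M].
have [X [PX Xmin]] := exists_span P.
pose AF := veronese_mx F; pose AG := veronese_mx G.
have subker N (C : 'M[K]_(#|{: I}|, N)) : (forall v, P v -> v *m C = 0) -> X *m C = 0.
  by move=> h; apply/sub_kermxP; apply: Xmin => v /h/sub_kermxP.
have XG : (X *m AG <= X)%MS.
  rewrite submxE; apply/eqP; rewrite -mulmxA; apply: subker => _ [M [MV Ms ->]].
  rewrite mulmxA -veroneseM; apply/eqP; rewrite -submxE; apply: PX.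
  exists (G M); split; rewrite ?GV //; apply: contra Ms => h.
  by rewrite -(FG M MV) Fu ?GV.
have XGF : X *m AG *m AF = X.
  apply/eqP; rewrite -subr_eq0 -{2}[X]mulmx1 -mulmxA -mulmxBr; apply/eqP.
  apply: subker => _ [M [MV Ms ->]].
  by rewrite mulmxBr mulmxA -!veroneseM FG // mulmx1 subrr.
have XXG : (X <= X *m AG)%MS.
  by rewrite -(mxrank_leqif_sup XG) eqn_leq mxrankS //= -{1}XGF mxrankM_maxl.
have XF : (X *m AF <= X)%MS.
  by rewrite -{2}XGF submxMr.
move=> M MV Ms; have vX : (veronese (F M) <= X)%MS.
  rewrite veroneseM; apply: submx_trans XF; apply: submxMr; apply: PX.
  by exists M.
have XD : X *m veronese_det = 0.
  apply: subker => _ [N [_ Ns ->]]; rewrite veronese_detE.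
  move: Ns; rewrite unitmxE unitfE negbK => /eqP ->.
  by apply/matrixP => i j; rewrite !mxE mul0rn.
have : veronese (F M) *m veronese_det = 0.
  by case/submxP: vX => D ->; rewrite -mulmxA XD mulmx0.
rewrite veronese_detE => /matrixP/(_ 0 0)/eqP; rewrite !mxE eqxx mulr1n => d0.
by rewrite unitmxE unitfE d0.
Qed.

End Dixon.

(** * Compression spaces attached to the points of a line *)

Section CompressionSpaces.
Variable K : fieldType.

Lemma compspaceS m n p q p' q' (U : 'M[K]_(p, m)) (X : 'M[K]_(q, n))
    (U' : 'M[K]_(p', m)) (X' : 'M[K]_(q', n)) :
  (U' <= U)%MS -> (X' <= X)%MS -> (compspace U X <= compspace U' X')%VS.
Proof.
case/submxP => C -> /submxP[D ->]; apply/subvP => M /compspaceP h; apply/compspaceP.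
by rewrite trmx_mul !mulmxA -[C *m U *m M]mulmxA -(mulmxA C) h mulmx0 mul0mx.
Qed.

Lemma eqmx_compspace m n p q p' q' (U : 'M[K]_(p, m)) (X : 'M[K]_(q, n))
    (U' : 'M[K]_(p', m)) (X' : 'M[K]_(q', n)) :
  (U :=: U')%MS -> (X :=: X')%MS -> compspace U X = compspace U' X'.
Proof.
by move=> UU' XX'; apply: subv_anti; rewrite !compspaceS ?UU' ?XX' ?submx_refl.
Qed.

Lemma compspace_addsmx m n p q q' (U : 'M[K]_(p, m)) (X : 'M[K]_(q, n))
    (X' : 'M[K]_(q', n)) : (compspace U X :&: compspace U X')%VS = compspace U (X + X')%MS.
Proof.
apply: subv_anti; apply/andP; split; last first.
  by rewrite subv_cap !compspaceS ?submx_refl ?addsmxSl ?addsmxSr.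
apply/subvP => M /memv_capP[/compspaceP h /compspaceP h'].
have [[C D] /= ->] := sub_addsmxP (submx_refl (X + X')%MS).
by apply/compspaceP; rewrite linearD /= mulmxDr !trmx_mul !mulmxA h h' !mul0mx addr0.
Qed.

Lemma compspace_singular n p q (U : 'M[K]_(p, n)) (X : 'M[K]_(q, n)) :
  (n < \rank U + \rank X)%N -> singular_space (compspace U X).
Proof.
move=> rUX M /compspaceP UMX; apply/negP => Mu.
have := mxrank_mul_ker (U *m M) X^T.
have rUM : \rank (U *m M) = \rank U by rewrite mxrankMfree ?row_free_unit.
have := mulmx0_rank_max UMX; rewrite rUM mxrank_tr; lia.
Qed.

Lemma trv_compspace m n p q (U : 'M[K]_(p, m)) (X : 'M[K]_(q, n)) :
  trv (compspace U X) = compspace X U.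
Proof.
apply/vspaceP => M; rewrite mem_trv.
by apply/compspaceP/compspaceP => h; apply: trmx_inj; rewrite !trmx_mul ?trmxK trmx0 mulmxA.
Qed.

Lemma trv_cap m n (A B : {vspace 'M[K]_(m, n)}) :
  trv (A :&: B) = (trv A :&: trv B)%VS.
Proof. by apply/vspaceP => M; rewrite memv_cap !mem_trv memv_cap. Qed.

Lemma submx_of_ker n p q (U : 'M[K]_(p, n)) (U' : 'M[K]_(q, n)) :
  (forall e : 'rV_n, U *m e^T = 0 -> U' *m e^T = 0) -> (U' <= U)%MS.
Proof.
move=> h; have : U *m cokermx U = 0 by apply/eqP; rewrite -submxE.
rewrite submxE; move: (cokermx U) => C UC; apply/eqP/mulmx_trV_eq0 => x.
by rewrite -mulmxA -[C *m x^T]trmxK h // trmxK mulmxA UC mul0mx.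
Qed.

Lemma rank1_in_compspace m n p q (U : 'M[K]_(p, m)) (X : 'M[K]_(q, n))
    (e : 'rV_m) (w : 'rV_n) :
  (e^T *m w \in compspace U X) = (U *m e^T == 0) || (w *m X^T == 0).
Proof.
apply/compspaceP/orP => [h|]; last first.
  by case=> /eqP h; [rewrite mulmxA h !mul0mx | rewrite -!mulmxA h !mulmx0].
have [_|wX] := eqVneq (w *m X^T) 0; [by right|left].
have /matrix0Pn[i [j]] := wX; rewrite ord1 => wXj.
have := congr1 (col j) h; rewrite col0 !mulmxA -mulmxA colE -mulmxA -colE.
rewrite [col j _]mx11_scalar mul_mx_scalar mxE => /eqP.
by rewrite scaler_eq0 (negPf wXj).
Qed.

(** Two compression spaces with the same trace on a third one: for e with U1 e^T = 0,
    all the matrices e^T w lie in the third space, and e^T w lies in the space (Ui, Xi)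
    if and only if Ui e^T = 0 or w Xi^T = 0. *)
Lemma compspace_dichotomy n p1 q1 p2 q2 p3 q3 (U1 : 'M[K]_(p1, n)) (X1 : 'M[K]_(q1, n))
    (U2 : 'M[K]_(p2, n)) (X2 : 'M[K]_(q2, n)) (U3 : 'M[K]_(p3, n)) (X3 : 'M[K]_(q3, n)) :
  (0 < \rank X2)%N -> (0 < \rank X3)%N ->
  (forall M, M \in compspace U1 X1 -> (M \in compspace U2 X2) = (M \in compspace U3 X3)) ->
  ((U2 <= U1)%MS /\ (U3 <= U1)%MS) \/ (X2 :=: X3)%MS.
Proof.
move=> rX2 rX3 h.
have nz q (X : 'M[K]_(q, n)) : (0 < \rank X)%N -> ~ (forall w : 'rV_n, w *m X^T = 0).
  move=> rX hX; have : X = 0.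
    apply: mulmx_trV_eq0 => x; apply: trmx_inj; rewrite trmx_mul trmxK trmx0.
    exact: hX.
  by move=> X0; rewrite X0 mxrank0 in rX.
have h1 (e w : 'rV_n) : U1 *m e^T = 0 ->
    (U2 *m e^T == 0) || (w *m X2^T == 0) = (U3 *m e^T == 0) || (w *m X3^T == 0).
  by move=> U1e; rewrite -!rank1_in_compspace h // rank1_in_compspace U1e eqxx.
have U23 (e : 'rV_n) : U1 *m e^T = 0 -> (U2 *m e^T == 0) = (U3 *m e^T == 0).
  move=> U1e; apply/idP/idP => Ue.
    apply/negPn/negP => ne; apply: (nz _ X3 rX3) => w; apply/eqP.
    by have := h1 e w U1e; rewrite Ue (negPf ne) /= => <-.
  apply/negPn/negP => ne; apply: (nz _ X2 rX2) => w; apply/eqP.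
  by have := h1 e w U1e; rewrite Ue (negPf ne) /= => ->.
case: (classic (exists2 e : 'rV_n, U1 *m e^T = 0 & U2 *m e^T <> 0)) => [[e U1e U2e]|ne].
  right; have ne2 : (U2 *m e^T == 0) = false by apply/eqP.
  have wE (w : 'rV_n) : (w *m X2^T == 0) = (w *m X3^T == 0).
    by have := h1 e w U1e; rewrite -U23 // ne2 /=.
  have trE q (X : 'M[K]_(q, n)) (w : 'rV_n) : (X *m w^T == 0) = (w *m X^T == 0).
    by rewrite -(inj_eq trmx_inj) trmx_mul trmxK trmx0.
  apply/eqmxP; rewrite !submx_of_ker // => w /eqP; rewrite trE => h'.
    by apply/eqP; rewrite trE -wE.
  by apply/eqP; rewrite trE wE.
left; have U2U1 : (U2 <= U1)%MS.
  by apply: submx_of_ker => e U1e; apply: NNPP => U2e; apply: ne; exists e.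
split=> //; apply: submx_of_ker => e U1e; apply/eqP; rewrite -U23 //; apply/eqP.
by case/submxP: U2U1 => D ->; rewrite -mulmxA U1e mulmx0.
Qed.

(** The dimensions of two images under f of the spaces attached to two points of a
    line in general position: each has codimension n in V, and their intersection has
    codimension 2n. *)
Definition cut_line n c (V A2 A3 : {vspace 'M[K]_n}) :=
  [/\ (\dim V + c = n * n)%N, (c + 2 <= n)%N,
      (\dim A2 + n = \dim V)%N, (\dim A3 + n = \dim V)%N
    & (\dim (A2 :&: A3) + 2 * n = \dim V)%N].

Lemma cut_by_compspace_arith n c dV dA dC k l : (dV + c = n * n -> c + 2 <= n ->
  dA + n = dV -> dA <= dC -> dC + k * l = n * n -> k + l = n.+1 ->
  1 < k -> 1 < l -> [/\ dC <= dA, c + 2 = n & k = 2 \/ l = 2])%N.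
Proof.
move=> h1 h2 h3 h4 h5 h6 h7 h8.
have [k' kE] : exists k', k = (k' + 2)%N by exists (k - 2)%N; lia.
have [l' lE] : exists l', l = (l' + 2)%N by exists (l - 2)%N; lia.
subst k l; have nE : n = (k' + l' + 3)%N by lia.
subst n; have kl : (k' * l' = 0)%N by nia.
by split; nia.
Qed.

(** If neither rank is 1, then a trace of codimension n on V is the whole compression
    space, the codimension of V is n - 2, and one of the ranks is 2. *)
Lemma cut_by_compspace_eq n c (V A : {vspace 'M[K]_n}) p q (U : 'M[K]_(p, n)) (X : 'M[K]_(q, n)) :
  (\dim V + c = n * n)%N -> (c + 2 <= n)%N -> (\dim A + n = \dim V)%N ->
  A = (V :&: compspace U X)%VS -> (\rank U + \rank X = n.+1)%N ->
  (1 < \rank U)%N -> (1 < \rank X)%N ->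
  [/\ A = compspace U X, (c + 2 = n)%N & \rank U = 2%N \/ \rank X = 2%N].
Proof.
move=> dV cn dA AE rUX U1 X1.
have sub : (A <= compspace U X)%VS by rewrite AE capvSr.
have [h1 h2 h3] := cut_by_compspace_arith dV cn dA (dimvS sub) (dim_compspace U X) rUX U1 X1.
by split=> //; apply/eqP; rewrite eqEdim sub.
Qed.

Lemma common_row_arith n c dV dI dA k l s : (dV + c = n * n -> c + 2 = n ->
  dI + 2 * n = dV -> dI + k * s = n * n -> dA + n = dV -> dA + k * l = n * n ->
  k + l = n.+1 -> k = 2 \/ l = 2 -> l < s -> s <= n -> 1 < l -> False)%N.
Proof.
move=> h1 h2 h3 h4 h5 h6 h7 [k2|l2] ls sn l1.
  by subst k; nia.
subst l; have [n' nE] : exists n', n = (n' + 1)%N by exists (n - 1)%N; lia.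
subst n; have kE : k = n' by lia.
subst k.
have [s3|s4] := leqP s 3; first by have sE : s = 3%N; [lia | subst s; nia].
have [s' sE] : exists s', s = (s' + 4)%N by exists (s - 4)%N; lia.
by subst s; nia.
Qed.

(** Two points of a line cannot have the same U, unless U is invertible. *)
Lemma cut_line_common_row n c (V A2 A3 : {vspace 'M[K]_n}) p2 q2 p3 q3
    (U2 : 'M[K]_(p2, n)) (X2 : 'M[K]_(q2, n)) (U3 : 'M[K]_(p3, n)) (X3 : 'M[K]_(q3, n)) :
  cut_line c V A2 A3 ->
  A2 = (V :&: compspace U2 X2)%VS -> A3 = (V :&: compspace U3 X3)%VS ->
  (\rank U2 + \rank X2 = n.+1)%N -> (\rank U3 + \rank X3 = n.+1)%N ->
  (\rank U2 < n)%N -> (U2 :=: U3)%MS -> False.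
Proof.
case=> dV cn dA2 dA3 dI A2E A3E r2 r3 kn U23.
have [X23|nX23] := boolP (X2 == X3)%MS.
  have A23 : A2 = A3 by rewrite A2E A3E (eqmx_compspace U23 (eqmxP X23)).
  rewrite A23 capvv in dI; lia.
have rU : \rank U2 = \rank U3 by rewrite U23.
have k1 : (1 < \rank U2)%N.
  rewrite ltnNge; apply: contra nX23 => k1.
  have f2 : row_full X2 by rewrite /row_full eqn_leq rank_leq_col /=; lia.
  have f3 : row_full X3 by rewrite /row_full eqn_leq rank_leq_col /=; lia.
  by rewrite !submx_full.
have l1 : (1 < \rank X2)%N by lia.
have [A2c cn' kl] := cut_by_compspace_eq dV cn dA2 A2E r2 k1 l1.
have [A3c _ _] := cut_by_compspace_eq dV cn dA3 A3E r3 (eq_ind _ (fun k => 1 < k)%N k1 _ rU) (ltac:(lia)).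
have IE : (A2 :&: A3)%VS = compspace U2 (X2 + X3)%MS.
  by rewrite A2c A3c -compspace_addsmx (eqmx_compspace (eqmx_sym U23) (eqmx_refl X3)).
have ls : (\rank X2 < \rank (X2 + X3)%MS)%N.
  rewrite ltn_neqAle mxrankS ?addsmxSl // andbT (mxrank_leqif_sup (addsmxSl X2 X3)).
  apply: contra nX23 => h.
  have X32 : (X3 <= X2)%MS by apply: submx_trans h; apply: addsmxSr.
  rewrite X32 andbT -(mxrank_leqif_sup X32) eqn_leq mxrankS //=; lia.
have dC := dim_compspace U2 (X2 + X3)%MS; rewrite -IE in dC.
have dC2 := dim_compspace U2 X2; rewrite -A2c in dC2.
exact: (common_row_arith dV cn' dI dC dA2 dC2 r2 kl ls (rank_leq_col _) l1).
Qed.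

Lemma cut_line_trv n c (V A2 A3 : {vspace 'M[K]_n}) :
  cut_line c V A2 A3 -> cut_line c (trv V) (trv A2) (trv A3).
Proof. by case=> *; split; rewrite -?trv_cap ?dim_trv. Qed.

(** Let A1, A2, A3 be the traces on V of three compression spaces, with the dimensions
    and the common pairwise intersection of the spaces attached to three points of a
    line. Then U1 or X1 has rank 1. Otherwise A1 is a whole compression space; its rank
    one matrices then show that (U2, X2) and (U3, X3) have the same U or the same X, or
    that A2 contains A1. *)
Lemma line_point_type n c (V A1 A2 A3 : {vspace 'M[K]_n}) p1 q1 p2 q2 p3 q3
    (U1 : 'M[K]_(p1, n)) (X1 : 'M[K]_(q1, n))
    (U2 : 'M[K]_(p2, n)) (X2 : 'M[K]_(q2, n)) (U3 : 'M[K]_(p3, n)) (X3 : 'M[K]_(q3, n)) :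
  cut_line c V A2 A3 ->
  (\dim A1 + n = \dim V)%N -> (A1 :&: A2 = A2 :&: A3)%VS -> (A1 :&: A3 = A2 :&: A3)%VS ->
  A1 = (V :&: compspace U1 X1)%VS -> A2 = (V :&: compspace U2 X2)%VS ->
  A3 = (V :&: compspace U3 X3)%VS ->
  (\rank U1 + \rank X1 = n.+1)%N -> (\rank U2 + \rank X2 = n.+1)%N ->
  (\rank U3 + \rank X3 = n.+1)%N ->
  \rank U1 = 1%N \/ \rank X1 = 1%N.
Proof.
move=> L dA1 I12 I13 A1E A2E A3E r1 r2 r3; have [dV cn dA2 dA3 dI] := L.
apply: NNPP => nt.
have [rU1 [rX1 [rU2 [rX2 [rU3 rX3]]]]] : (\rank U1 <= n /\ \rank X1 <= n /\ \rank U2 <= n /\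
  \rank X2 <= n /\ \rank U3 <= n /\ \rank X3 <= n)%N by rewrite !rank_leq_col.
have U1n : \rank U1 <> 1%N by move=> h; apply: nt; left.
have X1n : \rank X1 <> 1%N by move=> h; apply: nt; right.
have k1 : (1 < \rank U1)%N.
  by rewrite ltn_neqAle eq_sym (introN eqP U1n) /=; lia.
have l1 : (1 < \rank X1)%N.
  by rewrite ltn_neqAle eq_sym (introN eqP X1n) /=; lia.
have [A1c _ _] := cut_by_compspace_eq dV cn dA1 A1E r1 k1 l1.
have mem M : M \in compspace U1 X1 -> (M \in compspace U2 X2) = (M \in compspace U3 X3).
  move=> MC; have MV : M \in V by move: MC; rewrite -A1c A1E => /memv_capP[].
  have := congr1 (fun W : {vspace 'M[K]_n} => M \in W) (etrans I12 (esym I13)).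
  by rewrite /= !memv_cap A1c MC A2E A3E !memv_cap MV.
have memT M : M \in compspace X1 U1 -> (M \in compspace X2 U2) = (M \in compspace X3 U3).
  by rewrite -!(trv_compspace _ X1) -(trv_compspace U2) -(trv_compspace U3) !mem_trv; apply: mem.
have A12 : ~~ (A1 <= A2)%VS.
  apply/negP => /capv_idPl h; rewrite h in I12; rewrite -I12 in dI; lia.
have [pX2 pX3 pU2 pU3] : [/\ 0 < \rank X2, 0 < \rank X3, 0 < \rank U2 & 0 < \rank U3]%N.
  by split; lia.
have [[U21 U31]|X23] := compspace_dichotomy pX2 pX3 mem.
  have [[X21 X31]|U23] := compspace_dichotomy pU2 pU3 memT.
    case/negP: A12; rewrite A2E subv_cap A1c compspaceS // andbT -A1c A1E.
    exact: capvSl.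
  apply: (cut_line_common_row L A2E A3E r2 r3 _ U23).
  by have := mxrankS U21; lia.
have [[X21 X31]|U23] := compspace_dichotomy pU2 pU3 memT.
  have A2ET : trv A2 = (trv V :&: compspace X2 U2)%VS by rewrite A2E trv_cap trv_compspace.
  have A3ET : trv A3 = (trv V :&: compspace X3 U3)%VS by rewrite A3E trv_cap trv_compspace.
  apply: (cut_line_common_row (cut_line_trv L) A2ET A3ET _ _ _ X23); try lia.
  by have := mxrankS X21; lia.
have A23 : A2 = A3 by rewrite A2E A3E (eqmx_compspace U23 X23).
rewrite A23 capvv in dI; lia.
Qed.

(** Two points of a line cannot be of the types rank U = 1 and rank X = 1: their
    intersection would have codimension at most 2n - 1. *)
Lemma line_no_mixed n c (V A1 A2 : {vspace 'M[K]_n}) p1 q1 p2 q2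
    (U1 : 'M[K]_(p1, n)) (X1 : 'M[K]_(q1, n))
    (U2 : 'M[K]_(p2, n)) (X2 : 'M[K]_(q2, n)) :
  cut_line c V A1 A2 ->
  A1 = (V :&: compspace U1 X1)%VS -> A2 = (V :&: compspace U2 X2)%VS ->
  (\rank U1 + \rank X1 = n.+1)%N -> (\rank U2 + \rank X2 = n.+1)%N ->
  \rank U1 = 1%N -> \rank X2 = 1%N -> False.
Proof.
case=> dV cn dA1 dA2 dI A1E A2E r1 r2 U11 X21.
have full q (X : 'M[K]_(q, n)) : \rank X = n -> (X :=: 1%:M)%MS.
  by move=> rX; apply/eqmxP; rewrite submx1 sub1mx /row_full rX eqxx.
have X1f : (X1 :=: 1%:M)%MS by apply: full; lia.
have U2f : (U2 :=: 1%:M)%MS by apply: full; lia.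
have C1 := eqmx_compspace (eqmx_refl U1) X1f; have C2 := eqmx_compspace U2f (eqmx_refl X2).
have dC := dim_compspace_cap U1 (submx1 X2); rewrite U11 X21 mxrank1 -C1 -C2 in dC.
have sub : (V :&: (compspace U2 X2 :&: compspace U1 X1) <= A1 :&: A2)%VS.
  rewrite A1E A2E; apply/subvP => M /memv_capP[MV /memv_capP[h2 h1]].
  by apply/memv_capP; split; apply/memv_capP.
have dS := dimvS sub; have dsum := dimv_sum_cap V (compspace U2 X2 :&: compspace U1 X1).
have dle := leq_dimM (V + (compspace U2 X2 :&: compspace U1 X1))%VS.
move: dS dsum dle dC dI dV cn; unfold reverse_coercion.
move: (\dim _) (\dim _) => a b; move: (\dim _) (\dim _) (\dim _) => d e f.
lia.
Qed.

End CompressionSpaces.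

(** * Reconstruction of the map from the kernels *)

Section Preservers.
Variable K : fieldType.

(** If M x = 0 implies F(M) y = 0 for some y attached to x, for x = z and for all x
    outside S, then F(M) = P M Q on V. The main step is that the vectors y, y', y2
    attached to z, z', z + z' are linearly dependent, by a count of dimensions; this
    makes the matrices u, u', u2 with F(M) y = u (M z), etc., proportional. *)
Lemma kernel_preserver n c (V : {vspace 'M[K]_n}) (F : 'End('M[K]_n))
    (z : 'rV[K]_n) (S : 'M[K]_n) (y : 'rV[K]_n) :
  (\dim V + c = n * n)%N -> (c + 2 <= n)%N -> (\rank S < n)%N -> (z <= S)%MS ->
  (forall z' : 'rV_n, ~~ (z' <= S)%MS -> pair_onto V z z') ->
  (forall M, M \in V -> F M = 0 -> M = 0) ->
  (forall M, M \in V -> M \in unitmx -> F M \in unitmx) ->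
  y != 0 ->
  (forall M, M \in V -> M *m z^T = 0 -> F M *m y^T = 0) ->
  (forall M, M \in V -> F M *m y^T = 0 -> M *m z^T = 0) ->
  (forall z' : 'rV_n, ~~ (z' <= S)%MS -> exists2 y' : 'rV_n, y' != 0 &
     forall M, M \in V -> M *m z'^T = 0 -> F M *m y'^T = 0) ->
  exists P Q : 'M_n, [/\ P \in unitmx, Q \in unitmx &
    forall M, M \in V -> F M = P *m M *m Q].
Proof.
move=> dV cn rS zS onto Finj Fu y0 Fzy Fyz ker.
have imF (A : {vspace 'M[K]_n}) : (A <= V)%VS -> \dim (F @: A) = \dim A.
  move=> AV; apply: limg_dim_eq; apply/eqP; rewrite -subv0; apply/subvP => M.
  rewrite memv_cap memv_ker memv0 => /andP[/(subvP AV) MV /eqP FM].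
  by rewrite (Finj M).
have fac x y' : (forall p : 'cV_n, exists2 M, M \in V & M *m x^T = p) ->
    (forall M, M \in V -> M *m x^T = 0 -> F M *m y'^T = 0) ->
    exists u : 'M_n, forall M, M \in V -> F M *m y'^T = u *m (M *m x^T).
  move=> on h.
  have [||u uE] := @factor_through K _ _ _ V (sandwich (1%:M : 'M_n) x)
      (sandwich (1%:M : 'M_n) y' \o F)%VF.
  - by move=> p; have [M MV Mp] := on p; exists M; rewrite ?sandwichE ?mul1mx.
  - by move=> M MV; rewrite comp_lfunE !sandwichE !mul1mx; apply: h.
  by exists u => M MV; move: (uE M MV); rewrite comp_lfunE !sandwichE !mul1mx.
have nz (y' : 'rV_n) : y' != 0 -> ~ (forall M, M \in V -> F M *m y'^T = 0).
  move=> y'0 h; have sub : (F @: V <= compspace (1%:M : 'M_n) y')%VS.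
    by apply/subvP => _ /memv_imgP[M MV ->]; apply/compspaceP; rewrite mul1mx h.
  have := dimvS sub; rewrite imF ?subvv //.
  have := dim_compspace (1%:M : 'M[K]_n) y'; rewrite mxrank1 rank_rV y'0; dlia.
have [z1 z1S] := exists_outside rS.
have [|u uE] := fac z y _ Fzy.
  by move=> p; have [M [MV Mz _]] := onto _ z1S p 0; exists M.
have outD (z' : 'rV_n) : ~~ (z' <= S)%MS -> forall x : 'rV_n, (x <= S)%MS ->
    ~~ ((x + z')%R <= S)%MS.
  move=> z'S x xS; apply: contra z'S => h.
  by rewrite -[z'](addKr x) addmx_sub // -scaleN1r scalemx_sub.
suff T z' : ~~ (z' <= S)%MS -> exists s : 'rV_n, forall M, M \in V ->
    F M *m s^T = u *m (M *m z'^T).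
  have Tall x : exists s : 'rV_n, forall M, M \in V -> F M *m s^T = u *m (M *m x^T).
    have [xS|/T//] := boolP (x <= S)%MS.
    have [s1 s1E] := T _ z1S; have [s2 s2E] := T _ (outD _ z1S _ xS).
    exists (s2 - s1) => M MV.
    rewrite linearB mulmxBr s1E // s2E // linearD mulmxDr mulmxDr.
    by rewrite addrK.
  have [s sE] := fin_all_exists (fun i : 'I_n => Tall (row i 1%:M)).
  pose Q := (\matrix_i s i)^T.
  have QE M : M \in V -> F M *m Q = u *m M.
    move=> MV; apply: trmx_inj; apply/row_matrixP => i.
    rewrite !trmx_mul !row_mul trmxK rowK.
    have := congr1 trmx (sE i M MV); rewrite !trmx_mul !trmxK => ->.
    by rewrite row1 -rowE.
  have uu : u \in unitmx.
    apply: unitmx_of_ker => v uv; have [M [MV Mz _]] := onto _ z1S v^T 0.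
    apply: trmx_inj; rewrite trmx0 -Mz; apply: Fyz => //.
    by rewrite uE // Mz uv.
  have [M0 M0V M0u] : exists2 M0, M0 \in V & M0 \in unitmx.
    apply: NNPP => h; have := @dieudonne K n 0 V.
    suff -> : (forall M, M \in V -> 0 + M \notin unitmx) <-> True.
      by move=> /(_ I); dlia.
    by split=> // _ M MV; rewrite add0r; apply/negP => Mu; apply: h; exists M.
  have Qu : Q \in unitmx.
    have := QE M0 M0V => h; have : F M0 *m Q \in unitmx by rewrite h unitmx_mul uu.
    by rewrite unitmx_mul => /andP[].
  exists u, (invmx Q); rewrite uu unitmx_inv Qu; split=> // M MV.
  by rewrite -QE // mulmxK.
move=> z'S; have [y' y'0 Fz'] := ker _ z'S.
have zz'S := outD _ z'S _ zS; have [y2 y20 Fz2] := ker _ zz'S.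
have [|u' u'E] := fac z' y' _ Fz'.
  by move=> q; have [M [MV _ Mz']] := onto _ z'S 0 q; exists M.
have [|u2 u2E] := fac _ y2 _ Fz2.
  by move=> q; have [M [MV _ Mz']] := onto _ zz'S 0 q; exists M.
pose Y3 := col_mx y (col_mx y' y2).
have : kermx Y3 != 0.
  rewrite kermx_eq0 /row_free; apply/negP => /eqP rY.
  pose C := (V :&: compspace (1%:M : 'M_n) (col_mx z z'))%VS.
  have CP M : M \in C -> [/\ M \in V, M *m z^T = 0 & M *m z'^T = 0].
    case/memv_capP => MV /compspaceP; rewrite mul1mx tr_col_mx mul_mx_row -[0 in X in _ = X -> _]row_mx0.
    by case/eq_row_mx.
  have sub : (F @: C <= compspace (1%:M : 'M_n) Y3)%VS.
    apply/subvP => _ /memv_imgP[M /CP[MV Mz Mz'] ->]; apply/compspaceP.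
    rewrite mul1mx !tr_col_mx !mul_mx_row Fzy // Fz' // Fz2 ?row_mx0 //.
    by rewrite linearD mulmxDr Mz Mz' addr0.
  have d1 := dim_cap_compspace (1%:M : 'M_n) (col_mx z z') V.
  have d2 := dim_compspace (1%:M : 'M[K]_n) Y3; have d3 := dimvS sub.
  rewrite imF ?capvSl // in d3; rewrite mxrank1 rY in d2; rewrite mxrank1 -/C in d1.
  have r2 : (n * \rank (col_mx z z') <= n * 2)%N by rewrite leq_mul2l rank_leq_row orbT.
  move: d1 d2 d3 r2 dV cn; unfold reverse_coercion; clear.
  move: (\dim C) (\dim V) (\dim (compspace _ _)) (n * \rank _)%N => x1 x2 x3 x4.
  by rewrite /=; lia.
case/rowV0Pn => v /sub_kermxP; rewrite -[v]hsubmxK -[rsubmx v]hsubmxK !mul_row_col.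
set a := lsubmx v; set b := lsubmx (rsubmx v); set g := rsubmx (rsubmx v).
rewrite [a]mx11_scalar [b]mx11_scalar [g]mx11_scalar !mul_scalar_mx.
move: (a 0 0) (b 0 0) (g 0 0) => al be ga {a b g} rel vn0.
have comb (p q : 'cV_n) : al *: (u *m p) + (be *: (u' *m q) + ga *: (u2 *m (p + q))) = 0.
  have [M [MV Mz Mz']] := onto _ z'S p q.
  rewrite -Mz -Mz' -mulmxDr -linearD -uE // -u'E // -u2E //.
  rewrite !scalemxAr -!linearZ -!mulmxDr -!linearD /= rel trmx0 mulmx0 //.
have E1 : al *: u + ga *: u2 = 0.
  apply: mulmx_cV_inj => p; have := comb p 0.
  by rewrite mulmx0 scaler0 add0r addr0 mulmxDl -!scalemxAl mul0mx.
have E2 : be *: u' + ga *: u2 = 0.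
  apply: mulmx_cV_inj => q; have := comb 0 q.
  by rewrite mulmx0 scaler0 !add0r mulmxDl -!scalemxAl mul0mx.
have u0 : u != 0.
  by apply/eqP => h; apply: (nz _ y0) => M MV; rewrite uE // h mul0mx.
have u20 : u2 != 0.
  by apply/eqP => h; apply: (nz _ y20) => M MV; rewrite u2E // h mul0mx.
have u'0 : u' != 0.
  by apply/eqP => h; apply: (nz _ y'0) => M MV; rewrite u'E // h mul0mx.
have sc0 (k : K) (w : 'M[K]_n) : w != 0 -> k *: w = 0 -> k = 0.
  by move=> w0 /eqP; rewrite scaler_eq0 (negPf w0) orbF => /eqP.
have ga0 : ga != 0.
  apply: contraNneq vn0 => ga0; move: E1 E2; rewrite ga0 scale0r !addr0.
  move=> /(sc0 _ _ u0) -> /(sc0 _ _ u'0) ->.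
  by apply/eqP/matrixP => i j; rewrite !(mxE, mul0rn); case: split => k;
    rewrite !(mxE, mul0rn) //; case: split => k'; rewrite !mxE mul0rn.
have al0 : al != 0.
  apply: contraNneq ga0 => al0; move: E1; rewrite al0 scale0r add0r.
  by move/(sc0 _ _ u20) ->.
have bu' : be *: u' = al *: u.
  by apply: (addIr (ga *: u2)); rewrite E1 E2.
exists ((be / al) *: y') => M MV.
rewrite linearZ -scalemxAr u'E // mulrC -scalerA [be *: _]scalemxAl bu'.
by rewrite -scalemxAl scalerA mulVf // scale1r.
Qed.

End Preservers.

(** * Strong preservers of a large space *)

Section LargeSpace.
Variable K : fieldType.

Lemma maximal_arith n c dV dK dC k l s : (dV + c = n * n -> c + 2 <= n ->
  dV <= dK + n -> dK <= dC -> dC + k * (s - 1) + n * 1 = n * n ->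
  k + l = n.+1 -> l <= s -> k <= n -> l <= n -> k = n /\ s = 1)%N.
Proof.
move=> h1 h2 h3 h4 h5 h6 h7 h8 h9.
have [s' sE] : exists s', s = (s' + 1)%N by exists (s - 1)%N; lia.
subst s; rewrite addnK in h5.
have ks : (k * s' <= c)%N by lia.
have [k' kE] : exists k', k = (k' + 1)%N by exists (k - 1)%N; lia.
have [kn|kn] := leqP n k.
  have kE' : k = n by lia.
  split=> //; case: s' {h5 h7} ks => [//|s'] ks; rewrite kE' mulnS in ks; lia.
have [d nE] : exists d, n = (k + d + 1)%N by exists (n - k - 1)%N; lia.
have ds : (d + 1 <= s')%N by lia.
have : (k * (d + 1) <= c)%N by apply: leq_trans ks; rewrite leq_mul2l ds orbT.
by subst k n; nia.
Qed.

Lemma rank1_row q n (X : 'M[K]_(q, n)) : \rank X = 1%N ->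
  exists2 y : 'rV_n, y != 0 & (X :=: y)%MS.
Proof.
move=> rX; have X0 : X != 0 by rewrite -mxrank_eq0 rX.
have [y yX y0] : exists2 y : 'rV_n, (y <= X)%MS & y != 0.
  by have /rowV0Pn[y yX y0] := X0; exists y.
exists y => //; apply/eqmxP; rewrite yX andbT.
by rewrite -(mxrank_leqif_sup yX) rX rank_rV y0.
Qed.

Lemma full_rank q n (X : 'M[K]_(q, n)) : \rank X = n -> (X :=: 1%:M)%MS.
Proof. by move=> rX; apply/eqmxP; rewrite submx1 sub1mx /row_full rX eqxx. Qed.

Section Strong.
Variables (n c : nat) (V : {vspace 'M[K]_n}) (F G : 'End('M[K]_n)).
Hypotheses (dV : (\dim V + c = n * n)%N) (cn : (c + 2 <= n)%N).
Hypotheses (FV : forall M, M \in V -> F M \in V) (GV : forall M, M \in V -> G M \in V).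
Hypotheses (FG : forall M, M \in V -> F (G M) = M) (GF : forall M, M \in V -> G (F M) = M).
Hypothesis Funit : forall M, M \in V -> (F M \in unitmx) = (M \in unitmx).
Hypothesis gen : [\/ n != 3%N, c != 1%N | exists2 t : K, t != 0 & t != 1].

(** The space of the M in V with M x^T = 0. *)
Notation killed x := (V :&: compspace (1%:M : 'M[K]_n) x)%VS.

Lemma killedP (x : 'rV_n) M : reflect (M \in V /\ M *m x^T = 0) (M \in killed x).
Proof.
rewrite memv_cap; apply: (iffP andP) => -[MV h]; split=> //.
  by move/compspaceP: h; rewrite mul1mx.
by apply/compspaceP; rewrite mul1mx.
Qed.

(** { M in V | M x = 0 } is a maximal singular subspace of V. *)
Lemma killed_maximal (x : 'rV_n) (A : {vspace 'M[K]_n}) : x != 0 ->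
  (A <= V)%VS -> singular_space A -> (killed x <= A)%VS -> (A <= killed x)%VS.
Proof.
move=> x0 AV sing KA.
have dK : (\dim V <= \dim (killed x) + n)%N.
  by have := dim_cap_compspace (1%:M : 'M_n) x V; rewrite mxrank1 rank_rV x0 muln1.
have dKA := dimvS KA.
have [p [q [U [X [rUX sub]]]]] : compressible A.
  by apply: (atkinson_lloyd sing cn _ gen); move: dV dK dKA; dlia.
have Kc : (killed x <= compspace (1%:M : 'M_n) x :&: compspace U (x + X)%MS)%VS.
  rewrite -compspace_addsmx; apply/subvP => M /[dup] MK /killedP[MV Mx].
  rewrite !memv_cap (subvP sub) ?(subvP KA) // andbT.
  by apply/andP; split; apply/compspaceP; rewrite ?mul1mx -?mulmxA ?Mx ?mulmx0.
have dC := dim_compspace_cap U (addsmxSl x X); rewrite rank_rV x0 in dC.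
have ls : (\rank X <= \rank (x + X)%MS)%N by rewrite mxrankS ?addsmxSr.
have [rU s1] := maximal_arith dV cn dK (dimvS Kc) dC rUX ls (rank_leq_col _) (rank_leq_col _).
have rX : \rank X = 1%N by lia.
have xX : (x <= X)%MS.
  have Xs : (x + X <= X)%MS by rewrite -(mxrank_leqif_sup (addsmxSr x X)) rX s1.
  by apply: submx_trans Xs; apply: addsmxSl.
apply/subvP => M MA; apply/killedP; split; first exact: (subvP AV).
have := subvP (compspaceS (_ : (1%:M <= U)%MS) xX) M (subvP sub _ MA).
rewrite (full_rank rU) submx_refl => /(_ isT)/compspaceP.
by rewrite mul1mx.
Qed.

Lemma F_inj M : M \in V -> F M = 0 -> M = 0.
Proof. by move=> MV FM; rewrite -(GF MV) FM linear0. Qed.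

Lemma mem_imF (A : {vspace 'M[K]_n}) M : (A <= V)%VS -> M \in V ->
  (F M \in (F @: A)%VS) = (M \in A).
Proof.
move=> AV MV; apply/memv_imgP/idP => [[N NA FMN]|MA]; last by exists M.
by rewrite -(GF MV) FMN GF // (subvP AV).
Qed.

Lemma dim_imF (A : {vspace 'M[K]_n}) : (A <= V)%VS -> \dim (F @: A) = \dim A.
Proof.
move=> AV; apply: limg_dim_eq; apply/eqP; rewrite -subv0; apply/subvP => M.
rewrite memv_cap memv_ker memv0 => /andP[/(subvP AV) MV /eqP FM].
by rewrite (F_inj MV).
Qed.

Lemma imF_cap (A B : {vspace 'M[K]_n}) : (A <= V)%VS -> (B <= V)%VS ->
  (F @: (A :&: B) = F @: A :&: F @: B)%VS.
Proof.
move=> AV BV; apply: subv_anti; rewrite limg_cap; apply/subvP => N.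
move=> /memv_capP[/memv_imgP[M MA ->]]; rewrite mem_imF ?(subvP AV) // => MB.
by rewrite memv_img // memv_cap MA.
Qed.

(** F maps { M in V | M x = 0 } onto the trace on V of a compression space: the
    inverse image of this trace is singular, and { M in V | M x = 0 } is maximal. *)
Lemma image_killed (x : 'rV_n) : x != 0 ->
  exists p q (U : 'M_(p, n)) (X : 'M_(q, n)),
    (\rank U + \rank X = n.+1)%N /\ (F @: killed x)%VS = (V :&: compspace U X)%VS.
Proof.
move=> x0; have KV : (killed x <= V)%VS by apply: capvSl.
have dK : (\dim V <= \dim (killed x) + n)%N.
  by have := dim_cap_compspace (1%:M : 'M_n) x V; rewrite mxrank1 rank_rV x0 muln1.
have FKV : (F @: killed x <= V)%VS.
  by apply/subvP => _ /memv_imgP[M /(subvP KV) MV ->]; apply: FV.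
have singK : singular_space (killed x).
  move=> M /killedP[MV Mx]; apply/negP => Mu; case/eqP: x0.
  exact: unitmx_ker Mu Mx.
have sing : singular_space (F @: killed x)%VS.
  move=> _ /memv_imgP[M MK ->]; rewrite Funit ?singK //; exact: (subvP KV).
have [p [q [U [X [rUX sub]]]]] : compressible (F @: killed x)%VS.
  by apply: (atkinson_lloyd sing cn _ gen); rewrite dim_imF //; move: dV dK; dlia.
exists p, q, U, X; split=> //; apply: subv_anti; rewrite subv_cap FKV sub /=.
pose A := (G @: (V :&: compspace U X))%VS.
have AV : (A <= V)%VS.
  by apply/subvP => _ /memv_imgP[M /memv_capP[MV _] ->]; apply: GV.
have singA : singular_space A.
  move=> _ /memv_imgP[M /memv_capP[MV MC] ->]; rewrite -Funit ?GV // FG //.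
  by apply: (compspace_singular _ MC); rewrite rUX.
have AK : (A <= killed x)%VS.
  apply: killed_maximal => //; apply/subvP => M MK.
  have MV := subvP KV _ MK; apply/memv_imgP; exists (F M); last by rewrite GF.
  by rewrite memv_cap FV // (subvP sub) // memv_img.
apply/subvP => M /[dup] MVC /memv_capP[MV _]; apply/memv_imgP.
exists (G M); last by rewrite FG.
by apply: (subvP AK); apply: memv_img.
Qed.

Lemma pair_onto_dim (x y : 'rV_n) : pair_onto V x y ->
  [/\ (\dim (killed x) + n = \dim V)%N, (\dim (killed y) + n = \dim V)%N
    & (\dim (killed x :&: killed y) + 2 * n = \dim V)%N].
Proof.
move=> on.
have one (A : {vspace 'M[K]_n}) (z : 'rV_n) :
    (forall p : 'cV_n, exists2 M, M \in A & M *m z^T = p) ->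
    (\dim (A :&: compspace (1%:M : 'M_n) z) + n = \dim A)%N.
  move=> h; rewrite -(limg_ker_dim (sandwich (1%:M : 'M_n) z) A) -/(compspace _ _).
  suff -> : (sandwich (1%:M : 'M_n) z @: A)%VS = fullv by rewrite dimvM muln1.
  apply: subv_anti; rewrite subvf /=; apply/subvP => p _.
  by have [M MA <-] := h p; apply/memv_imgP; exists M; rewrite ?sandwichE ?mul1mx.
have d1 : (\dim (killed x) + n = \dim V)%N.
  by apply: one => p; have [M [MV Mx _]] := on p 0; exists M.
split=> //; first by apply: one => q; have [M [MV _ My]] := on 0 q; exists M.
have : (\dim (killed x :&: compspace (1%:M : 'M_n) y) + n = \dim (killed x))%N.
  apply: one => q; have [M [MV Mx My]] := on 0 q; exists M => //.
  by apply/killedP.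
have -> : (killed x :&: killed y = killed x :&: compspace (1%:M : 'M_n) y)%VS.
  by apply/vspaceP => M; rewrite !memv_cap; case: (M \in V).
by move: d1; lia.
Qed.

Lemma killed_add (x y : 'rV_n) :
  (killed x :&: killed (x + y) = killed x :&: killed y)%VS /\
  (killed y :&: killed (x + y) = killed x :&: killed y)%VS.
Proof.
have E M : M *m (x + y)^T = M *m x^T + M *m y^T by rewrite linearD mulmxDr.
split; apply/vspaceP => M; apply/memv_capP/memv_capP;
  case=> /killedP[MV h1] /killedP[_ h2]; split; apply/killedP; split=> //;
  move: h1 h2; rewrite ?E.
- by move=> ->; rewrite add0r.
- by move=> -> ->; rewrite addr0.
- by move=> ->; rewrite addr0.
- by move=> -> ->; rewrite addr0.
Qed.

(** All the points z' of the regular lines through z have the type of z. *)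
Lemma line_types (z z' : 'rV_n) p q (U : 'M_(p, n)) (X : 'M_(q, n)) :
  z != 0 -> z' != 0 -> z + z' != 0 -> pair_onto V z z' -> pair_onto V z (z + z') ->
  (\rank U + \rank X = n.+1)%N -> (F @: killed z)%VS = (V :&: compspace U X)%VS ->
  (\rank X = 1%N /\ exists2 y : 'rV_n, y != 0 &
     (F @: killed z')%VS = (V :&: compspace (1%:M : 'M_n) y)%VS) \/
  (\rank U = 1%N /\ exists2 y : 'rV_n, y != 0 &
     (F @: killed z')%VS = (V :&: compspace y (1%:M : 'M_n))%VS).
Proof.
move=> z0 z'0 zz'0 on on' r1 E1.
have [p2 [q2 [U2 [X2 [r2 E2]]]]] := image_killed z'0.
have [p3 [q3 [U3 [X3 [r3 E3]]]]] := image_killed zz'0.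
have [d1 d2 d12] := pair_onto_dim on; have [_ d3 _] := pair_onto_dim on'.
have [K13 K23] := killed_add z z'.
have sV (x : 'rV_n) : (killed x <= V)%VS by apply: capvSl.
pose A1 := (F @: killed z)%VS; pose A2 := (F @: killed z')%VS.
pose A3 := (F @: killed (z + z'))%VS.
have I13 : (A1 :&: A3 = A1 :&: A2)%VS by rewrite -!imF_cap // K13.
have I23 : (A2 :&: A3 = A1 :&: A2)%VS by rewrite -!imF_cap // K23.
have dA12 : (\dim (A1 :&: A2) + 2 * n = \dim V)%N.
  by rewrite -imF_cap // dim_imF // (subv_trans (capvSl _ _)).
have dA1 : (\dim A1 + n = \dim V)%N by rewrite dim_imF.
have dA2 : (\dim A2 + n = \dim V)%N by rewrite dim_imF.
have dA3 : (\dim A3 + n = \dim V)%N by rewrite dim_imF.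
have L23 : cut_line c V A2 A3 by split; rewrite ?I23.
have L13 : cut_line c V A1 A3 by split; rewrite ?I13.
have L12 : cut_line c V A1 A2 by split.
have L21 : cut_line c V A2 A1 by split; rewrite // capvC.
have t1 : \rank U = 1%N \/ \rank X = 1%N.
  by apply: (line_point_type L23 dA1 _ _ E1 E2 E3 r1 r2 r3); rewrite I23 ?I13.
have t2 : \rank U2 = 1%N \/ \rank X2 = 1%N.
  by apply: (line_point_type L13 dA2 _ _ E2 E1 E3 r2 r1 r3); rewrite ?I23 I13 // capvC.
case: t1 => [U1|X1]; [right|left]; split=> //.
  case: t2 => [U21|X21]; last by case: (line_no_mixed L12 E1 E2 r1 r2 U1 X21).
  have [y y0 Uy] := rank1_row U21; exists y => //; rewrite E2.
  by rewrite (eqmx_compspace Uy (full_rank _)) //; lia.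
case: t2 => [U21|X21]; first by case: (line_no_mixed L21 E2 E1 r2 r1 U21 X1).
have [y y0 Xy] := rank1_row X21; exists y => //; rewrite E2.
by rewrite (eqmx_compspace (full_rank _) Xy) //; lia.
Qed.

Theorem strong_preserver_standard :
  exists P Q : 'M_n, [/\ P \in unitmx, Q \in unitmx &
    (forall M, M \in V -> F M = P *m M *m Q) \/
    (forall M, M \in V -> F M = P *m M^T *m Q)].
Proof.
have [z [S [z0 rS zS onto]]] := @regular_point K n n V c (ltac:(lia)) cn.
have [z1 z1S] := exists_outside rS.
have out0 (x : 'rV_n) : ~~ (x <= S)%MS -> x != 0.
  by apply: contraNneq => ->; apply: sub0mx.
have outD (x : 'rV_n) : ~~ (x <= S)%MS -> ~~ ((z + x)%R <= S)%MS.
  by apply: contra => h; rewrite -[x](addKr z) addmx_sub // -scaleN1r scalemx_sub.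
have [p [q [U [X [rUX E]]]]] := image_killed z0.
have types z' : ~~ (z' <= S)%MS -> _ := fun z'S =>
  line_types z0 (out0 _ z'S) (out0 _ (outD _ z'S)) (onto _ z'S) (onto _ (outD _ z'S)) rUX E.
have killF (x : 'rV_n) M : M \in V -> (F M \in (F @: killed x)%VS) = (M *m x^T == 0).
  move=> MV; rewrite mem_imF ?capvSl //.
  by apply/killedP/eqP => [[]|].
case: (types _ z1S) => -[r1 _].
  have [y y0 Xy] := rank1_row r1.
  have Ey : (F @: killed z = V :&: compspace (1%:M : 'M_n) y)%VS.
    by rewrite E (eqmx_compspace (full_rank _) Xy) //; lia.
  have [||||P [Q [Pu Qu PQ]]] := kernel_preserver dV cn rS zS onto F_inj _ y0; last first.
  - by exists P, Q; split=> //; left.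
  - move=> z' z'S; case: (types _ z'S) => -[r2]; last by move=> _; lia.
    case=> y' y'0 E'; exists y' => // M MV Mz'.
    have : F M \in (F @: killed z')%VS by rewrite killF // Mz'.
    by rewrite E' => /killedP[].
  - move=> M MV FMy; apply/eqP; rewrite -killF // Ey; apply/killedP.
    by rewrite FV.
  - move=> M MV Mz; have : F M \in (F @: killed z)%VS by rewrite killF // Mz.
    by rewrite Ey => /killedP[].
  by move=> M MV Mu; rewrite Funit.
have [y y0 Uy] := rank1_row r1.
pose F' : 'End('M[K]_n) := (linfun (@trmx K n n) \o F)%VF.
have F'E M : F' M = (F M)^T by rewrite comp_lfunE lfunE.
have rowsP (x : 'rV_n) M : M \in V -> (M \in (V :&: compspace x (1%:M : 'M_n))%VS) = (M^T *m x^T == 0).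
  move=> MV; rewrite memv_cap MV /= -trmx_mul -(inj_eq trmx_inj) trmxK trmx0.
  by apply/compspaceP/eqP; rewrite trmx1 mulmx1.
have Ey : (F @: killed z = V :&: compspace y (1%:M : 'M_n))%VS.
  by rewrite E (eqmx_compspace Uy (full_rank _)) //; lia.
have [|||||P [Q [Pu Qu PQ]]] := @kernel_preserver K n c V F' z S y dV cn rS zS onto _ _ y0; last first.
- exists Q^T, P^T; rewrite !unitmx_tr; split=> //; right=> M /PQ; rewrite F'E => h.
  by rewrite -[F M]trmxK h !trmx_mul mulmxA.
- move=> z' z'S; case: (types _ z'S) => -[r2]; first by move=> _; lia.
  case=> y' y'0 E'; exists y' => // M MV Mz'.
  have : F M \in (F @: killed z')%VS by rewrite killF // Mz'.
  by rewrite E' rowsP ?FV // F'E => /eqP.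
- move=> M MV; rewrite F'E => /eqP FMy; apply/eqP.
  by rewrite -killF // Ey rowsP // FV.
- move=> M MV Mz; have : F M \in (F @: killed z)%VS by rewrite killF // Mz.
  by rewrite Ey rowsP ?FV // F'E => /eqP.
- by move=> M MV Mu; rewrite F'E unitmx_tr Funit.
move=> M MV; rewrite F'E => h; apply: F_inj => //.
by rewrite -[F M]trmxK h trmx0.
Qed.

End Strong.
End LargeSpace.

(** * Weak preservers of a large space *)

Section TwoElements.
Variable K : fieldType.

Lemma field_two_elements : (forall t : K, t = 0 \/ t = 1) -> field_isomorphic K 'F_2.
Proof.
move=> two; pose phi (t : K) : 'F_2 := if t == 0 then 0 else 1.
have phi0 : phi 0 = 0 by rewrite /phi eqxx.
have phi1 : phi 1 = 1 by rewrite /phi oner_eq0.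
have two0 : (1 + 1 : K) = 0.
  case: (two (1 + 1)) => // h; case/eqP: (oner_neq0 K).
  by apply: (addrI 1); rewrite h addr0.
have N1 : - 1 = 1 :> K by apply/eqP; rewrite eq_sym -addr_eq0 two0.
have phiB : {morph phi : x y / x - y}.
  move=> x y; case: (two x) => ->; case: (two y) => ->;
    rewrite ?subr0 ?sub0r ?subrr ?N1 ?phi0 ?phi1 ?subr0 ?subrr //.
  by apply/eqP.
have phiM : {morph phi : x y / x * y}.
  by move=> x y; case: (two x) => ->; rewrite ?mul0r ?mul1r ?phi0 ?phi1 ?mul0r ?mul1r.
pose phiZ := GRing.isZmodMorphism.Build _ _ phi phiB.
pose phiR := GRing.isMonoidMorphism.Build _ _ phi (conj phi1 phiM).
pose psi : {rmorphism K -> 'F_2} := HB.pack phi phiZ phiR.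
exists psi; exists (fun a : 'F_2 => if a == 0 then 0 else 1) => [x|a].
  rewrite /= /phi; case: (two x) => ->; first by rewrite eqxx eqxx.
  by rewrite !oner_eq0.
by rewrite /= /phi; case: a => -[|[|//]] i; apply/val_inj => /=; rewrite ?eqxx ?oner_eq0.
Qed.

End TwoElements.

Theorem theorem2 (K : fieldType) (n : nat) (V : {vspace 'M[K]_n})
    (f : {linear subvs_of V -> subvs_of V}) :
  (0 < n)%N ->
  (codimv V < n - 1)%N ->
  bijective f ->
  (forall A : subvs_of V, vsval A \in unitmx -> vsval (f A) \in unitmx) ->
  ~ [/\ n = 3%N, codimv V = 1%N & field_isomorphic K 'F_2] ->
  exists u : 'M[K]_n -> 'M[K]_n,
    Frobenius_automorphism u /\ (forall A : subvs_of V, u (vsval A) = vsval (f A)).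
Proof.
move=> _ codim fbij funit exc.
(* F and G extend f and its inverse to the space of all matrices. *)
pose h := linfun f; have hE A : h A = f A by rewrite lfunE.
have h0 : lker h == 0%VS.
  by apply/lker0P => A B; rewrite !hE; apply: bij_inj.
pose F : 'End('M[K]_n) := linfun (vsval \o (f \o vsproj V)).
pose G : 'End('M[K]_n) := linfun (vsval \o (h^-1%VF \o vsproj V)).
have FE A : F (vsval A) = vsval (f A) by rewrite lfunE /= vsvalK.
have GE A : G (vsval A) = vsval (h^-1%VF A) by rewrite lfunE /= vsvalK.
have inV (P : 'M[K]_n -> Prop) : (forall A : subvs_of V, P (vsval A)) ->
    forall M, M \in V -> P M.
  by move=> PA M MV; rewrite -(vsprojK MV).
have FV : forall M, M \in V -> F M \in V.
  by apply: inV => A; rewrite FE subvsP.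
have GV : forall M, M \in V -> G M \in V.
  by apply: inV => A; rewrite GE subvsP.
have FG : forall M, M \in V -> F (G M) = M.
  by apply: inV => A; rewrite GE FE -hE lker0_lfunVK.
have GF : forall M, M \in V -> G (F M) = M.
  by apply: inV => A; rewrite FE GE -hE lker0_lfunK.
have Fu : forall M, M \in V -> M \in unitmx -> F M \in unitmx.
  by apply: inV => A; rewrite FE; apply: funit.
have Funit M : M \in V -> (F M \in unitmx) = (M \in unitmx).
  move=> MV; apply/idP/idP; last exact: Fu.
  apply: contraTT; exact: (preserves_singular GV FG Fu).
have dV : (\dim V + codimv V = n * n)%N.
  by rewrite /codimv addnC subnK dimvM // leq_dimM.
have cn : (codimv V + 2 <= n)%N by lia.
have gen : [\/ n != 3%N, codimv V != 1%N | exists2 t : K, t != 0 & t != 1].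
  have [n3|] := eqVneq n 3%N; last by constructor 1.
  have [c1|] := eqVneq (codimv V) 1%N; last by constructor 2.
  constructor 3; apply: NNPP => nt; apply: exc; split=> //.
  apply: field_two_elements => t; have [|t0] := eqVneq t 0; [by left|right].
  by apply/eqP/negPn/negP => t1; apply: nt; exists t.
have [P [Q [Pu Qu PQ]]] :=
  strong_preserver_standard dV cn FV GV FG GF Funit gen.
case: PQ => PQ.
  exists (fun M => P *m M *m Q); split; first by exists P, Q; split=> //; left.
  by move=> A; rewrite -FE PQ ?subvsP.
exists (fun M => P *m M^T *m Q); split; first by exists P, Q; split=> //; right.
by move=> A; rewrite -FE PQ ?subvsP.
Qed.
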